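(* Let $G=\widetilde{\mathrm{U}(1)}^2\simeq\mathbb{R}^2$ act on $\mathbb{C}^3$ by $(\theta_1,\theta_2)\cdot(z_1,z_2,z_3)=(e^{i\theta_1}z_1,e^{i\theta_2}z_2,z_3-i(\theta_1+\theta_2))$, and define $\mu:\mathbb{C}^3\to\mathbb{R}^3$ by $$\mu(z_1,z_2,z_3)=\Big(\mathrm{Re}\,z_3-\tfrac12|z_1|^2,\ \mathrm{Re}\,z_3-\tfrac12|z_2|^2,\ \mathrm{Im}(z_1z_2e^{z_3})\Big).$$ The differential $d\mu$ is surjective at $(z_1,z_2,z_3)$ if and only if $(z_1,z_2)\ne(0,0)$. For every $(a,b,c)\in\mathbb{R}^3$, the smooth part of the fibre $L_{a,b,c}:=\mu^{-1}(a,b,c)$ (the points with $(z_1,z_2)\neq(0,0)$) is a $G$-invariant cohomogeneity-one Lagrangian translating soliton in $\mathbb{C}^3$. Moreover, for every $a\in\mathbb{R}$ the fibre $L_{a,a,0}$ has the 1-dimensional singular set $\{(0,0,a+it):t\in\mathbb{R}\}$, and it is Hamiltonian stationary, i.e. the Lagrangian angle of its smooth part is harmonic.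
   Context: $\mathbb{C}^3$ carries the standard metric, Kähler form $\omega_0=\sum dx_i\wedge dy_i$ and $\Omega_0=dz_1\wedge dz_2\wedge dz_3$; $e_3=(0,0,1)$. A Lagrangian translating soliton (in the $e_3$ direction) is a Lagrangian submanifold whose mean curvature vector satisfies $\vec H=e_3^\perp$ (normal part of $e_3$); equivalently, locally, $\theta+\mathrm{Im}\,z_3$ is constant, where the Lagrangian angle $\theta$ is defined by $\Omega_0|_L=e^{i\theta}\mathrm{vol}_L$. Harmonicity of $\theta$ is with respect to the induced metric. A $G$-invariant $n$-dimensional manifold is cohomogeneity-one if all its points have the same isotropy type $(H)$ and $\dim(G/H)=n-1$. *)

(* Defs.v *)
From HB Require Import structures.
From mathcomp Require Import all_boot all_order all_algebra.
From mathcomp Require Import complex.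
From mathcomp Require Import all_classical all_reals all_analysis.

Set Implicit Arguments.
Unset Strict Implicit.
Unset Printing Implicit Defensive.

Import Order.TTheory GRing.Theory Num.Theory.
Import numFieldNormedType.Exports.

Local Open Scope classical_set_scope.
Local Open Scope complex_scope.
Local Open Scope ring_scope.

(* Meant for V open, where it is the usual C^k regularity. *)
Fixpoint Ck (R : realType) (U W : normedModType R) (k : nat)
    (V : set U) (f : U -> W) : Prop :=
  match k with
  | 0 => forall x, V x -> {for x, continuous f}
  | k'.+1 => (forall x, V x -> differentiable f x) /\
             (forall v, Ck k' V ('D_v f))
  end.

Definition smooth_on (R : realType) (U W : normedModType R)
    (V : set U) (f : U -> W) : Prop := forall k, Ck k V f.

(* phi, restricted to the open set V, is a smooth immersion which is a
   homeomorphism from V onto a relatively open subset of L. *)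
Record local_param (R : realType) (n N : nat) (L : set 'rV[R]_N)
    (V : set 'rV[R]_n) (phi : 'rV[R]_n -> 'rV[R]_N) : Prop := LocalParam {
  lp_open : open V;
  lp_smooth : smooth_on V phi;
  lp_immersion : forall u, V u -> injective ('d phi u);
  lp_inj : {in V &, injective phi};
  lp_homeo : forall W : set 'rV[R]_n, open W -> W `<=` V ->
    exists2 U : set 'rV[R]_N, open U & phi @` W = L `&` U
}.

Definition regular_at (R : realType) (n N : nat) (L : set 'rV[R]_N)
    (p : 'rV[R]_N) : Prop :=
  exists V phi, @local_param R n N L V phi /\ (phi @` V) p.

Definition submanifold (R : realType) (n N : nat) (L : set 'rV[R]_N) : Prop :=
  forall p, L p -> regular_at n L p.

Definition singular_set (R : realType) (n N : nat) (L : set 'rV[R]_N) :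
    set 'rV[R]_N := [set p | L p /\ ~ regular_at n L p].

Definition tangent_space (R : realType) (n N : nat) (L : set 'rV[R]_N)
    (p : 'rV[R]_N) : set 'rV[R]_N :=
  [set X | exists V phi u v, [/\ @local_param R n N L V phi, V u, phi u = p
                              & X = 'd phi u v]].

Definition partial (R : realType) (n : nat) (W : normedModType R) (i : 'I_n)
    (f : 'rV[R]_n -> W) : 'rV[R]_n -> W := 'D_(delta_mx 0 i) f.

Definition dotv (R : realType) (N : nat) (x y : 'rV[R]_N) : R :=
  \sum_(i < N) x 0 i * y 0 i.

Definition metric (R : realType) (n N : nat) (phi : 'rV[R]_n -> 'rV[R]_N)
    (u : 'rV[R]_n) : 'M[R]_n :=
  \matrix_(i, j) dotv (partial i phi u) (partial j phi u).

Definition inv_metric (R : realType) (n N : nat) (phi : 'rV[R]_n -> 'rV[R]_N)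
    (u : 'rV[R]_n) : 'M[R]_n := invmx (metric phi u).

(* v minus its orthogonal projection to the span of the vectors d_i phi (u). *)
Definition normal_part (R : realType) (n N : nat)
    (phi : 'rV[R]_n -> 'rV[R]_N) (u : 'rV[R]_n) (v : 'rV[R]_N) : 'rV[R]_N :=
  v - \sum_(i < n) \sum_(j < n)
        (inv_metric phi u i j * dotv v (partial i phi u)) *: partial j phi u.

(* The trace (not divided by n) of the second fundamental form
   II(d_i phi, d_j phi) = normal part of d_i d_j phi. *)
Definition mean_curvature (R : realType) (n N : nat)
    (phi : 'rV[R]_n -> 'rV[R]_N) (u : 'rV[R]_n) : 'rV[R]_N :=
  \sum_(i < n) \sum_(j < n)
    inv_metric phi u i j *: normal_part phi u (partial i (partial j phi) u).

(* Gamma^k_ij for the metric induced by phi. *)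
Definition christoffel (R : realType) (n N : nat)
    (phi : 'rV[R]_n -> 'rV[R]_N) (k i j : 'I_n) (u : 'rV[R]_n) : R :=
  let g a b := fun w => metric phi w a b : R in
  2^-1 * \sum_(l < n) inv_metric phi u k l *
    (partial i (g j l) u + partial j (g i l) u - partial l (g i j) u).

(* Laplace-Beltrami operator of the induced metric, as the trace of the
   covariant Hessian. *)
Definition laplacian (R : realType) (n N : nat)
    (phi : 'rV[R]_n -> 'rV[R]_N) (f : 'rV[R]_n -> R) (u : 'rV[R]_n) : R :=
  \sum_(i < n) \sum_(j < n) inv_metric phi u i j *
    (partial i (partial j f) u
     - \sum_(k < n) christoffel phi k i j u * partial k f u).

(* C^n is R^(n + n): the real parts come first, then the imaginary parts. *)
Definition zcoord (R : realType) (n : nat) (p : 'rV[R]_(n + n)) (j : 'I_n) :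
    R[i] := p 0 (lshift n j) +i* p 0 (rshift n j).

Definition cvec (R : realType) (n : nat) (z : 'I_n -> R[i]) : 'rV[R]_(n + n) :=
  row_mx (\row_j complex.Re (z j)) (\row_j complex.Im (z j)).

Definition omega0 (R : realType) (n : nat) (X Y : 'rV[R]_(n + n)) : R :=
  \sum_(j < n) (complex.Re (zcoord X j) * complex.Im (zcoord Y j)
                - complex.Im (zcoord X j) * complex.Re (zcoord Y j)).

Definition Omega0 (R : realType) (n : nat) (X : 'I_n -> 'rV[R]_(n + n)) :
    R[i] := \det (\matrix_(j, k) zcoord (X j) k).

Definition expi (R : realType) (t : R) : R[i] := cos t +i* sin t.

Definition cexp (R : realType) (z : R[i]) : R[i] :=
  (expR (complex.Re z))%:C * expi (complex.Im z).

Definition lagrangian (R : realType) (n : nat) (L : set 'rV[R]_(n + n)) : Prop :=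
  submanifold n L /\
  forall p X Y, L p -> tangent_space n L p X -> tangent_space n L p Y ->
    omega0 X Y = 0.

Definition lagrangian_translating_soliton (R : realType) (n : nat)
    (e : 'rV[R]_(n + n)) (L : set 'rV[R]_(n + n)) : Prop :=
  lagrangian L /\
  forall V phi, @local_param R n (n + n) L V phi ->
    forall u, V u -> mean_curvature phi u = normal_part phi u e.

(* Omega0|_L = e^(i theta) vol_L, read on the frame (d_1 phi, ..., d_n phi),
   with the image of phi oriented by this frame. Reversing the orientation
   shifts theta by pi, which is immaterial for harmonicity. *)
Definition lagrangian_angle (R : realType) (n : nat) (V : set 'rV[R]_n)
    (phi : 'rV[R]_n -> 'rV[R]_(n + n)) (theta : 'rV[R]_n -> R) : Prop :=
  smooth_on V theta /\
  forall u, V u -> Omega0 (fun i => partial i phi u)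
    = expi (theta u) * (Num.sqrt (\det (metric phi u)))%:C.

(* In general theta is only globally defined modulo 2 pi (pi if L is not
   oriented), so one works with its local determinations; these exist around
   every point, and each of them is harmonic. *)
Definition hamiltonian_stationary (R : realType) (n : nat)
    (L : set 'rV[R]_(n + n)) : Prop :=
  [/\ lagrangian L,
      forall p, L p -> exists V phi theta,
        [/\ @local_param R n (n + n) L V phi, (phi @` V) p
          & lagrangian_angle V phi theta]
    & forall V phi theta, @local_param R n (n + n) L V phi ->
        lagrangian_angle V phi theta ->
        forall u, V u -> laplacian phi theta u = 0].

Definition isotropy (R : realType) (k : nat) (T : Type)
    (act : 'rV[R]_k -> T -> T) (p : T) : set 'rV[R]_k := [set g | act g p = p].

(* dim (R^k / H) = d, the Lie algebra of the closed subgroup H being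
   {X | exp (tX) \in H for all t}, with exp the identity of R^k. *)
Definition homogeneous_dim (R : realType) (k : nat) (H : set 'rV[R]_k)
    (d : nat) : Prop :=
  exists h : {vspace 'rV[R]_k},
    (forall X, X \in h <-> forall t : R, H (t *: X)) /\ (d + \dim h = k)%N.

Definition cohomogeneity_one (R : realType) (k n N : nat)
    (act : 'rV[R]_k -> 'rV[R]_N -> 'rV[R]_N) (M : set 'rV[R]_N) : Prop :=
  [/\ submanifold n M,
      forall g p, M p -> M (act g p)
    & exists H : set 'rV[R]_k,
      [/\ closed H,
          H 0 /\ (forall g h, H g -> H h -> H (g - h)),
          (forall p, M p -> exists g,
             isotropy act p = [set g + h - g | h in H])
        & exists2 d, homogeneous_dim H d & d.+1 = n]].

Definition C3 (R : realType) (z1 z2 z3 : R[i]) : 'rV[R]_(3 + 3) :=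
  cvec (fun j : 'I_3 => [:: z1; z2; z3]`_j).

Definition z1 (R : realType) (p : 'rV[R]_(3 + 3)) : R[i] :=
  zcoord p (@Ordinal 3 0 isT).
Definition z2 (R : realType) (p : 'rV[R]_(3 + 3)) : R[i] :=
  zcoord p (@Ordinal 3 1 isT).
Definition z3 (R : realType) (p : 'rV[R]_(3 + 3)) : R[i] :=
  zcoord p (@Ordinal 3 2 isT).

Definition e3 (R : realType) : 'rV[R]_(3 + 3) := C3 0 0 1.

Definition act (R : realType) (g : 'rV[R]_2) (p : 'rV[R]_(3 + 3)) :
    'rV[R]_(3 + 3) :=
  let t1 := g 0 0 in let t2 := g 0 1 in
  C3 (expi t1 * z1 p) (expi t2 * z2 p) (z3 p - (0 +i* (t1 + t2))).

Definition vec3 (R : realType) (a b c : R) : 'rV[R]_3 :=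
  \row_(j < 3) [:: a; b; c]`_j.

Definition mu (R : realType) (p : 'rV[R]_(3 + 3)) : 'rV[R]_3 :=
  vec3 (complex.Re (z3 p) - 2^-1 * Normc.normc (z1 p) ^+ 2)
       (complex.Re (z3 p) - 2^-1 * Normc.normc (z2 p) ^+ 2)
       (complex.Im (z1 p * z2 p * cexp (z3 p))).

Definition fibre (R : realType) (a b c : R) : set 'rV[R]_(3 + 3) :=
  [set p | mu p = vec3 a b c].

Definition smooth_part (R : realType) (L : set 'rV[R]_(3 + 3)) :
    set 'rV[R]_(3 + 3) := [set p | L p /\ (z1 p, z2 p) <> (0, 0)].

Lemma z1_C3 (R : realType) (x y z : R[i]) : z1 (C3 x y z) = x.
Proof.
by rewrite /z1 /C3 /zcoord /cvec row_mxEl row_mxEr !mxE /=; case: x.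
Qed.

Lemma z2_C3 (R : realType) (x y z : R[i]) : z2 (C3 x y z) = y.
Proof.
by rewrite /z2 /C3 /zcoord /cvec row_mxEl row_mxEr !mxE /=; case: y.
Qed.

Lemma z3_C3 (R : realType) (x y z : R[i]) : z3 (C3 x y z) = z.
Proof.
by rewrite /z3 /C3 /zcoord /cvec row_mxEl row_mxEr !mxE /=; case: z.
Qed.

Lemma expiD (R : realType) (s t : R) : expi (s + t) = expi s * expi t.
Proof.
by rewrite /expi cosD sinD; apply/eqP; rewrite eq_complex /= addrC eqxx addrC eqxx.
Qed.

Lemma C3_zcoord (R : realType) (p : 'rV[R]_(3 + 3)) :
  C3 (z1 p) (z2 p) (z3 p) = p.
Proof.
rewrite /C3 /cvec -[RHS]hsubmxK; congr row_mx; apply/rowP => j; rewrite !mxE;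
  by case: j => [[|[|[|//]]] lt] /=; congr (p _ _); exact: val_inj.
Qed.

Lemma act0 (R : realType) (p : 'rV[R]_(3 + 3)) : act 0 p = p.
Proof.
by rewrite /act !mxE addr0 subr0 /expi cos0 sin0 !mul1r C3_zcoord.
Qed.

Lemma actD (R : realType) (g h : 'rV[R]_2) (p : 'rV[R]_(3 + 3)) :
  act (g + h) p = act g (act h p).
Proof.
rewrite /act !mxE z1_C3 z2_C3 z3_C3 !expiD !mulrA.
congr (C3 _ _ _); case: (z3 p) => x y.
by apply/eqP; rewrite eq_complex /= !subr0 eqxx /= addrACA opprD addrA addrAC.
Qed.

(* Main.v *)
Require Import Defs.
From HB Require Import structures.
From mathcomp Require Import all_boot all_order all_algebra.
From mathcomp Require Import complex.
From mathcomp Require Import all_classical all_reals all_analysis.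
From mathcomp Require Import ring lra.

(** At a point with (z_1, z_2) <> (0, 0) the kernel of the differential of mu is spanned
    by the two generators of the action and by W, the conjugate of
    e^(i Im z_3) (z_2, z_1, z_1 z_2) (a real multiple of the gradient of
    z_1 z_2 e^(z_3)).  Multiplication by i maps this basis to normals with the same Gram
    matrix, so the fibre is Lagrangian.  Differentiating the orthogonality of the normals
    and the coordinate frame expresses the mean curvature through the trace of the
    Hessian of mu over the tangent space; the trace does not depend on the chosen basis,
    and on the basis above it is minus the pairing with e_3, which is the soliton equation.

    The Lagrangian angle is - Im z_3 up to a constant, and the Laplacian of a linear
    function on a submanifold is its pairing with the mean curvature.  On a fibre with
    c = 0 this pairing of the direction of Im z_3 with the normal part of e_3 vanishes.

    The smooth part has explicit charts (r, t, s) with r + i c = z_1 z_2 e^(z_3),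
    t = Im z_2 / Re z_2 and s = Im z_3, where |z_2|^2 is recovered from r by inverting a
    function of one variable.  At a point (0, 0, a + it) the fibre contains curves whose
    velocities span four dimensions, which excludes a three-dimensional chart. *)

Set Implicit Arguments.
Unset Strict Implicit.
Unset Printing Implicit Defensive.

Import Order.TTheory GRing.Theory Num.Theory.
Import numFieldNormedType.Exports.

Local Open Scope classical_set_scope.
Local Open Scope complex_scope.
Local Open Scope ring_scope.

(** The soliton equation and the harmonicity of the angle are claimed in every local
    parametrization, so they cannot be checked in one convenient chart. What makes this tractable is
    that the orthogonal projector D^T (D D^T)^-1 D is the same for the coordinate frame and for the
    explicit tangent frame. After this exchange the claims become rational identities in the
    coordinates modulo cos^2 + sin^2 = 1, with the single denominator [gdet] = |z_1|^2 |z_2|^2 +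
    |z_1|^2 + |z_2|^2, which vanishes exactly where z_1 = z_2 = 0.

    The normals are the gradients of the components of [mu], the third one up to a positive factor.
    The first two components are moment maps of the two factors of the group and the third is
    invariant, so the three Poisson-commute; this is why i times a tangent vector is normal.

    Explicit charts serve only to prove that the smooth part is a submanifold. There r is a
    G-invariant parameter across the orbits, while t and s move along them. Charts with Re z_2 > 0
    are enough, because linear symmetries bring every point of the smooth part to that position. *)

(** * Rules for C^k functions and smoothness of the elementary functions *)

Section Calculus.
Variable R : realType.

(** The difference g - f vanishes near x, hence is differentiable there with differential 0. *)
Lemma near_eq_differentiable (U W : normedModType R) (f g : U -> W) (x : U) :
  (\near x, f x = g x) -> differentiable f x -> differentiable g x.
Proof.
move=> fg df.
have -> : g = f + (g - f) by rewrite addrC subrK.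
apply: differentiableD => //.
have fgx : f x = g x := nbhs_singleton fg.
have h0 : (g - f) x = 0 by rewrite -[LHS]/(g x - f x) fgx subrr.
have key : (g - f) \o shift x = cst ((g - f) x) + \0 +o_ 0 id.
  apply/eqaddoP => _/posnumP[e]; near=> y.
  rewrite h0 !fctE /= addr0 subr0.
  suff -> : f (y + x) = g (y + x) by rewrite subrr normr0.
  near: y.
  suff : \forall y \near (0 : U), f (y + x) = g (y + x) by [].
  move: fg; rewrite (near_shift 0).
  by apply: filterS => y /=; rewrite subr0.
have d0 : 'd (g - f) x = \0 :> (U -> W).
  by apply: diff_unique key => ?; exact: cst_continuous.
apply/diff_locallyP; rewrite d0; split => // ?; exact: cst_continuous.
Unshelve. all: by end_near. Qed.

Lemma open_near_eq (U : topologicalType) (W : Type) (V : set U) (f g : U -> W) x :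
  open V -> V x -> (forall y, V y -> f y = g y) -> \near x, f x = g x.
Proof.
by move=> oV Vx fg; near=> y; apply: fg; near: y; exact: open_nbhs_nbhs.
Unshelve. all: by end_near. Qed.

(** [Ck] differentiates functions given on the whole space, while the product and chain rules hold
    only at points of V; this lemma lets formulas valid on V alone be used in the inductions
    below. *)
Lemma Ck_ext (U W : normedModType R) (V : set U) k (f g : U -> W) : open V ->
  (forall x, V x -> f x = g x) -> Ck k V f -> Ck k V g.
Proof.
move=> oV; elim: k f g => [|k IH] f g fg /=.
  move=> fc x Vx; have nfg := open_near_eq oV Vx fg.
  suff : g y @[y --> x] --> g x by [].
  by rewrite -(fg _ Vx); apply: cvg_trans (fc x Vx); exact: near_eq_cvg.
move=> [df Df]; split=> [x Vx|v].
  exact: near_eq_differentiable (open_near_eq oV Vx fg) (df x Vx).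
apply: IH (Df v) => x Vx.
exact: near_eq_derive (open_near_eq oV Vx fg).
Qed.

Lemma CkW (U W : normedModType R) (V : set U) k (f : U -> W) :
  Ck k.+1 V f -> Ck k V f.
Proof.
elim: k f => [|k IH] f [df Df].
  by move=> x Vx; apply: differentiable_continuous; exact: df.
by split=> // v; apply: IH; exact: Df.
Qed.

Lemma Ck_sub (U W : normedModType R) (V V' : set U) k (f : U -> W) :
  V' `<=` V -> Ck k V f -> Ck k V' f.
Proof.
move=> sV; elim: k f => [|k IH] f /=; first by move=> fc x /sV /fc.
by move=> [df Df]; split=> [x /sV/df//|v]; exact: IH.
Qed.

Lemma Ck_cst (U W : normedModType R) (V : set U) k (c : W) : Ck k V (cst c : U -> W).
Proof.
elim: k c => [|k IH] c; first by move=> x _; exact: cst_continuous.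
split=> [x _|v]; first exact: differentiable_cst.
suff -> : 'D_v (cst c : U -> W) = cst 0 by [].
by apply/funext => x; rewrite derive_cst.
Qed.

Lemma CkD (U W : normedModType R) (V : set U) k (f g : U -> W) : open V ->
  Ck k V f -> Ck k V g -> Ck k V (f + g).
Proof.
move=> oV; elim: k f g => [|k IH] f g.
  by move=> fc gc x Vx; apply: continuousD; [exact: fc|exact: gc].
move=> [df Df] [dg Dg]; split=> [x Vx|v].
  by apply: differentiableD; [exact: df|exact: dg].
apply: (Ck_ext oV _ (IH _ _ (Df v) (Dg v))) => x Vx.
by rewrite deriveD //; apply: diff_derivable; [exact: df|exact: dg].
Qed.

Lemma CkM (U : normedModType R) (V : set U) k (f g : U -> R) : open V ->
  Ck k V f -> Ck k V g -> Ck k V (f * g).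
Proof.
move=> oV; elim: k f g => [|k IH] f g.
  by move=> fc gc x Vx; apply: continuousM; [exact: fc|exact: gc].
move=> fk gk; case: (fk) => df Df; case: (gk) => dg Dg; split=> [x Vx|v].
  by apply: differentiableM; [exact: df|exact: dg].
have H1 := IH _ _ (CkW fk) (Dg v); have H2 := IH _ _ (CkW gk) (Df v).
apply: (Ck_ext oV _ (CkD oV H1 H2)) => x Vx.
by rewrite deriveM //; apply: diff_derivable; [exact: df|exact: dg].
Qed.

Lemma derive_linear (U W W' : normedModType R) (L : {linear W -> W'})
    (f : U -> W) x v : continuous L -> differentiable f x ->
  'D_v (L \o f) x = L ('D_v f x).
Proof.
move=> cL df; have dL y : differentiable L y by exact: linear_differentiable.
rewrite deriveE; last exact: differentiable_comp.
by rewrite diff_comp // diff_lin //= deriveE.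
Qed.

Lemma Ck_linear (U W W' : normedModType R) (V : set U) (L : {linear W -> W'}) k
    (f : U -> W) : open V -> continuous L -> Ck k V f -> Ck k V (L \o f).
Proof.
move=> oV cL; elim: k f => [|k IH] f.
  move=> fc x Vx; apply: continuous_comp; [exact: fc|exact: cL].
move=> [df Df]; split=> [x Vx|v].
  by apply: differentiable_comp; [exact: df|exact: linear_differentiable].
apply: (Ck_ext oV _ (IH _ (Df v))) => x Vx.
by rewrite derive_linear //; exact: df.
Qed.

Lemma scalel_Ck (U W : normedModType R) (V : set U) k (f : U -> R) (w : W) :
  open V -> Ck k V f -> Ck k V (fun x => f x *: w).
Proof.
move=> oV; elim: k f => [|k IH] f.
  move=> fc x Vx; apply: cvgZr_tmp; exact: fc.
move=> [df Df]; split=> [x Vx|v].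
  by apply: differentiableZl; exact: df.
apply: (Ck_ext oV _ (IH _ (Df v))) => x Vx.
have dfx := df x Vx.
by rewrite deriveE //  deriveE; [rewrite diffZl|exact: differentiableZl].
Qed.

Lemma Ck_sum (U W : normedModType R) (V : set U) k n (f : 'I_n -> U -> W) :
  open V -> (forall i, Ck k V (f i)) -> Ck k V (fun x => \sum_(i < n) f i x).
Proof.
move=> oV; elim: n f => [|n IH] f fC.
  have -> : (fun x => \sum_(i < 0) f i x) = cst 0.
    by apply/funext => x; rewrite big_ord0.
  exact: Ck_cst.
have -> : (fun x => \sum_(i < n.+1) f i x) =
    (fun x => \sum_(i < n) f (widen_ord (leqnSn n) i) x) + f ord_max.
  by apply/funext => x; rewrite big_ord_recr.
by apply: CkD => //; exact: IH.
Qed.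

Lemma Ck_rV (U : normedModType R) (V : set U) k n (f : U -> 'rV[R]_n) :
  open V -> (forall i, Ck k V (fun x => f x 0 i)) -> Ck k V f.
Proof.
move=> oV fC.
have -> : f = (fun x => \sum_(i < n) f x 0 i *: delta_mx 0 i).
  by apply/funext => x; rewrite [LHS]row_sum_delta.
by apply: Ck_sum => // i; exact: scalel_Ck.
Qed.

Lemma derive_comp1 (U : normedModType R) (h : R -> R) (f : U -> R) x v :
  differentiable f x -> differentiable h (f x) ->
  'D_v (h \o f) x = 'D_1 h (f x) * 'D_v f x.
Proof.
move=> df dh; rewrite deriveE; last exact: differentiable_comp.
rewrite diff_comp //= [in RHS]deriveE // [in RHS]deriveE //.
by rewrite -[X in 'd _ _ X = _]mulr1 [LHS]linearZ mulrC.
Qed.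

(** A scalar outer function suffices for the charts, and it reduces the chain rule to a product: the
    derivative of the composite is ('D_1 h o f) times that of f, so the induction closes with
    [CkM]. *)
Lemma Ck_comp (U : normedModType R) (V : set U) (I : set R) k (h : R -> R)
    (f : U -> R) : open V -> Ck k I h -> Ck k V f -> (forall x, V x -> I (f x)) ->
  Ck k V (h \o f).
Proof.
move=> oV; elim: k h f => [|k IH] h f.
  move=> hc fc fI x Vx; apply: continuous_comp; [exact: fc|exact/hc/fI].
move=> hk fk fI; case: (hk) => dh Dh; case: (fk) => df Df; split=> [x Vx|v].
  by apply: differentiable_comp; [exact: df|exact/dh/fI].
have H := CkM oV (IH _ _ (Dh 1) (CkW fk) fI) (Df v).
apply: (Ck_ext oV _ H) => x Vx.
by rewrite derive_comp1 //; [exact: df|exact/dh/fI].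
Qed.

Lemma Ck1S (I : set R) k (h : R -> R) :
  (forall x, I x -> derivable h x 1) -> Ck k I ('D_1 h) -> open I -> Ck k.+1 I h.
Proof.
move=> dh Dh oI; split=> [x Ix|v]; first by apply/derivable1_diffP; exact: dh.
have H := CkM oI (Ck_cst I k v) Dh.
apply: (Ck_ext oI _ H) => x Ix; have /derivable1_diffP dhx := dh x Ix.
by rewrite !fctE deriveE // [RHS]deriveE // -[in RHS](mulr1 v) [RHS]linearZ.
Qed.

Lemma is_derive_Ck1 (I : set R) k (h h' : R -> R) : open I ->
  (forall x, I x -> is_derive x 1 h (h' x)) -> Ck k I h' -> Ck k.+1 I h.
Proof.
move=> oI dh h'k; apply: Ck1S => // [x Ix|]; first by case: (dh x Ix).
by apply: (Ck_ext oI _ h'k) => x Ix; case: (dh x Ix).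
Qed.

Lemma smooth_expR : smooth_on setT (@expR R).
Proof.
elim=> [|k IH]; first by move=> x _; exact: continuous_expR.
by apply: is_derive_Ck1 IH => //; exact: openT.
Qed.

Lemma smooth_sin_cos : smooth_on setT (@sin R) /\ smooth_on setT (@cos R).
Proof.
suff H k : Ck k setT (@sin R) /\ Ck k setT (@cos R).
  by split=> k; case: (H k).
(* Each function is the derivative of the other up to sign, so both go through one induction. *)
elim: k => [|k [IHs IHc]].
  by split=> x _; [exact: continuous_sin|exact: continuous_cos].
split; first by apply: is_derive_Ck1 IHc => //; exact: openT.
apply: (@is_derive_Ck1 _ _ _ (cst (-1) * sin)); first exact: openT.
  by move=> x _; rewrite !fctE mulN1r; exact: is_derive_cos.
apply: CkM IHs; [exact: openT|exact: Ck_cst].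
Qed.

Lemma open_neq0 : open [set x : R | x != 0].
Proof. exact: open_neq. Qed.

Lemma smooth_inv : smooth_on [set x : R | x != 0] (@GRing.inv R).
Proof.
elim=> [|k IH]; first by move=> x /= x0; exact: inv_continuous.
apply: (@is_derive_Ck1 _ _ _ (cst (-1) * (GRing.inv * GRing.inv))).
- exact: open_neq0.
- move=> x /= x0.
  apply: is_derive_eq; first exact: (@is_deriveV _ id x _ 1 x0).
  by rewrite /GRing.scale /= mulr1 !fctE mulN1r expr2 invfM.
- apply: CkM; [exact: open_neq0|exact: Ck_cst|].
  by apply: CkM => //; exact: open_neq0.
Qed.

Lemma smooth_sqrt : smooth_on [set x : R | 0 < x] (@Num.sqrt R).
Proof.
have oI : open [set x : R | 0 < x] by exact: open_gt.
elim=> [|k IH]; first by move=> x /= _; exact: sqrt_continuous.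
apply: (@is_derive_Ck1 _ _ _ (GRing.inv \o (cst 2 * Num.sqrt))) => //.
apply: (@Ck_comp _ _ [set x | x != 0]) => //; first exact: smooth_inv.
  by apply: CkM => //; exact: Ck_cst.
by move=> x /= x0; rewrite !fctE mulf_neq0 // gt_eqF // sqrtr_gt0.
Qed.

(* The derivative of h is a smooth function of h itself, so the regularity bootstraps. *)
Lemma smooth_inverse (I J : set R) (f f' h : R -> R) : open I -> open J ->
  (forall y, I y -> J (h y)) ->
  smooth_on J f' -> (forall x, J x -> f' x != 0) ->
  (forall y, I y -> is_derive y 1 h (f' (h y))^-1) -> smooth_on I h.
Proof.
move=> oI oJ hJ sf' f'0 dh; elim=> [|k IH].
  move=> y Iy; apply: differentiable_continuous; apply/derivable1_diffP.
  by case: (dh y Iy).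
apply: (@is_derive_Ck1 _ _ _ (GRing.inv \o (f' \o h))) => //.
apply: (@Ck_comp _ _ [set x | x != 0]) => //; first exact: smooth_inv.
  by apply: (@Ck_comp _ _ J) => //; exact: sf'.
by move=> y /= Iy; apply: f'0; exact: hJ.
Qed.

End Calculus.

(** * Symmetry of second derivatives *)

Section Schwarz.
Variable R : realType.
Variable U : normedModType R.

Lemma is_derive_line (W : normedModType R) (f : U -> W) (y v : U) (t : R) :
  differentiable f (t *: v + y) ->
  is_derive t 1 (fun s : R => f (s *: v + y)) ('D_v f (t *: v + y)).
Proof.
move=> df.
have dl : is_diff t (fun s : R => s *: v + y) (fun s : R => s *: v).
  by apply: is_diff_eq; rewrite addr0.
have dfl : differentiable (f \o (fun s : R => s *: v + y)) t.
  by apply: differentiable_comp.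
split; first exact: diff_derivable.
rewrite deriveE //.
have -> : (fun s : R => f (s *: v + y)) = f \o (fun s : R => s *: v + y) by [].
by rewrite diff_comp //= diff_val scale1r deriveE.
Qed.

Lemma MVT_line (f : U -> R) (y v : U) (h : R) : 0 < h ->
  (forall t, 0 <= t <= h -> differentiable f (t *: v + y)) ->
  exists2 t, 0 <= t <= h & f (h *: v + y) - f y = 'D_v f (t *: v + y) * h.
Proof.
move=> h0 df.
have dg t : t \in `[0, h]%R ->
    is_derive t 1 (fun s : R => f (s *: v + y)) ('D_v f (t *: v + y)).
  by rewrite in_itv /= => th; apply: is_derive_line; exact: df.
pose g (s : R) : R := f (s *: v + y).
pose dg' (s : R) : R := 'D_v f (s *: v + y).
have cg : {within `[0, h], continuous g}.
  by apply: derivable_within_continuous => t /dg [].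
have dg1 t : t \in `]0, h[%R -> is_derive t 1 g (dg' t).
  by move=> th; apply: dg; exact: subset_itv_oo_cc.
have [t] := MVT_segment (ltW h0) dg1 cg.
rewrite in_itv /= => th e; exists t => //.
by move: e; rewrite /g scale0r add0r subr0.
Qed.

(** The mean value theorem twice: along v for y |-> f (h w + y) - f y, then along w for the
    derivative of f in direction v. *)
Lemma second_difference (V : set U) (f : U -> R) (x v w : U) (h : R) : 0 < h ->
  Ck 2 V f ->
  (forall s t, 0 <= s <= h -> 0 <= t <= h -> V (s *: w + (t *: v + x))) ->
  exists s t, [/\ 0 <= s <= h, 0 <= t <= h &
   f (h *: w + (h *: v + x)) - f (h *: w + x) - (f (h *: v + x) - f x)
    = 'D_w ('D_v f) (s *: w + (t *: v + x)) * h * h].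
Proof.
move=> h0 [df Df] VV.
have h00 : 0 <= h <= h by rewrite lexx ltW.
have z00 : 0 <= (0 : R) <= h by rewrite lexx ltW.
pose g := fun y => f (h *: w + y) - f y.
have dsh y : is_diff y (fun y => h *: w + y) id.
  by apply: is_diff_eq; rewrite add0r.
have dg t : 0 <= t <= h -> differentiable g (t *: v + x) /\
   'D_v g (t *: v + x) = 'D_v f (h *: w + (t *: v + x)) - 'D_v f (t *: v + x).
  move=> th.
  have d1 : differentiable f (h *: w + (t *: v + x)) by exact/df/VV.
  have d2 : differentiable f (t *: v + x).
    by have /df := VV 0 t z00 th; rewrite scale0r add0r.
  have d3 : differentiable (f \o (fun y => h *: w + y)) (t *: v + x).
    by apply: differentiable_comp.
  split; first exact: differentiableB.
  rewrite -[g]/((f \o (fun y => h *: w + y)) - f) deriveB ?deriveE //.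
  - by rewrite diff_comp //= diff_val.
  - exact: diff_derivable.
  - exact: diff_derivable.
have [t th e1] : exists2 t, 0 <= t <= h &
    g (h *: v + x) - g x = 'D_v g (t *: v + x) * h.
  by apply: MVT_line => // t /dg[].
have [s sh e2] : exists2 s, 0 <= s <= h &
   'D_v f (h *: w + (t *: v + x)) - 'D_v f (t *: v + x) =
   'D_w ('D_v f) (s *: w + (t *: v + x)) * h.
  apply: MVT_line => // s sh; have [dDf _] := Df v; exact/dDf/VV.
exists s, t; split => //; have [_ e3] := dg t th.
rewrite -e2 -e3 -e1 /g; ring.
Qed.

(** The second difference over a small parallelogram is symmetric in v and w, so the two mixed
    derivatives agree at two points near x; continuity at x finishes. *)
Lemma schwarz (V : set U) (f : U -> R) (x v w : U) : open V -> Ck 2 V f -> V x ->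
  'D_v ('D_w f) x = 'D_w ('D_v f) x.
Proof.
move=> oV f2 Vx; have [_ Df] := f2.
have [_ Dvw] := Df w; have [_ Dwv] := Df v.
apply/eqP; rewrite -subr_eq0 -normr_le0; apply/ler_addgt0Pl => e e0.
rewrite addr0.
have e20 : 0 < e / 2 by rewrite divr_gt0.
have n0 : \near x, V x by exact: open_nbhs_nbhs.
have n1 : \forall t \near x, `|'D_v ('D_w f) x - 'D_v ('D_w f) t| < e / 2.
  by have /cvgrPdist_lt/(_ _ e20) := Dvw v x Vx.
have n2 : \forall t \near x, `|'D_w ('D_v f) x - 'D_w ('D_v f) t| < e / 2.
  by have /cvgrPdist_lt/(_ _ e20) := Dwv w x Vx.
have n3 : nbhs x (V `&` ([set t | `|'D_v ('D_w f) x - 'D_v ('D_w f) t| < e / 2]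
    `&` [set t | `|'D_w ('D_v f) x - 'D_w ('D_v f) t| < e / 2])).
  exact: (filterI n0 (filterI n1 n2)).
move: n3 => /nbhs_ballP[r /= r0 rP].
pose c := `|v| + `|w| + 1.
have c0 : 0 < c by rewrite ltr_wpDl // addr_ge0.
(* A parallelogram with sides h v and h w then stays within r / 2 of x; the 1 in [c] covers v = w =
   0. *)
pose h := r / (2 * c).
have h0 : 0 < h by rewrite divr_gt0 // mulr_gt0.
have inb s t a b : 0 <= s <= h -> 0 <= t <= h -> 
    `|a| <= c -> `|b| <= c -> `|a| + `|b| < c -> ball x r (s *: a + (t *: b + x)).
  move=> /andP[s0 sh] /andP[t0 th] ac bc abc; rewrite -ball_normE /=.
  rewrite addrA opprD addrCA subrr addr0 normrN.
  apply: le_lt_trans (ler_normD _ _) _; rewrite !normrZ !ger0_norm //.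
  apply: (@le_lt_trans _ _ (h * (`|a| + `|b|))).
    by rewrite mulrDr lerD // ler_wpM2r.
  apply: (@lt_trans _ _ (h * c)); first by rewrite ltr_pM2l.
  by rewrite /h invfM mulrA divfK ?gt_eqF // ltr_pdivrMr // mulr_natr mulr2n ltrDl.
have vc : `|v| <= c by rewrite /c -addrA lerDl addr_ge0.
have wc : `|w| <= c by rewrite /c addrAC lerDr addr_ge0.
have vwc : `|v| + `|w| < c by rewrite ltrDl.
have wvc : `|w| + `|v| < c by rewrite addrC.
have [s [t [sh th e1]]] : exists s t, [/\ 0 <= s <= h, 0 <= t <= h &
   f (h *: w + (h *: v + x)) - f (h *: w + x) - (f (h *: v + x) - f x)
    = 'D_w ('D_v f) (s *: w + (t *: v + x)) * h * h].
  by apply: (@second_difference V) => // s t sh th; case: (rP _ (inb s t w v sh th wc vc wvc)).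
have [s' [t' [sh' th' e2]]] : exists s t, [/\ 0 <= s <= h, 0 <= t <= h &
   f (h *: v + (h *: w + x)) - f (h *: v + x) - (f (h *: w + x) - f x)
    = 'D_v ('D_w f) (s *: v + (t *: w + x)) * h * h].
  by apply: (@second_difference V) => // s' t' sh' th'; case: (rP _ (inb s' t' v w sh' th' vc wc vwc)).
have [_ [_ /= p2]] := rP _ (inb s t w v sh th wc vc wvc).
have [_ [/= p1 _]] := rP _ (inb s' t' v w sh' th' vc wc vwc).
have e3 : 'D_v ('D_w f) (s' *: v + (t' *: w + x)) = 'D_w ('D_v f) (s *: w + (t *: v + x)).
  have hh : h * h != 0 by rewrite mulf_neq0 ?gt_eqF.
  apply: (mulIf hh).
  have e1' := etrans e1 (esym (mulrA _ h h)); have e2' := etrans e2 (esym (mulrA _ h h)).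
  refine (etrans (esym e2') (etrans _ e1')); rewrite [h *: v + (_ + x)]addrCA; ring.
rewrite e3 in p1.
set A := 'D_v _ _ in p1 *; set B := 'D_w _ x in p2 *.
set C := 'D_w _ _ in p1 p2.
have -> : A - B = (A - C) - (B - C) by ring.
clearbody A B C; have nle := ler_normB (A - C) (B - C).
apply: (le_trans nle); rewrite (splitr e); exact: (lerD (ltW p1) (ltW p2)).
Qed.

End Schwarz.

(** * Explicit tangent and normal frames and their Gram matrix *)

Section Frames.
Variable R : realType.
Implicit Types (p v w : 'rV[R]_(3 + 3)).

Definition o0 : 'I_3 := @Ordinal 3 0 isT.
Definition o1 : 'I_3 := @Ordinal 3 1 isT.
Definition o2 : 'I_3 := @Ordinal 3 2 isT.

Lemma ord3P (P : 'I_3 -> Prop) : P o0 -> P o1 -> P o2 -> forall i, P i.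
Proof.
by move=> P0 P1 P2 [[|[|[|//]]] lt]; [have -> : Ordinal lt = o0 by exact: val_inj
  |have -> : Ordinal lt = o1 by exact: val_inj
  |have -> : Ordinal lt = o2 by exact: val_inj].
Qed.

Lemma sum_ord3 (V : nmodType) (F : 'I_3 -> V) :
  \sum_(i < 3) F i = F o0 + F o1 + F o2.
Proof.
rewrite !big_ord_recr big_ord0 /= add0r.
by congr (F _ + F _ + F _); exact: val_inj.
Qed.

Definition xc (j : 'I_3) p : R := p 0 (lshift 3 j).
Definition yc (j : 'I_3) p : R := p 0 (rshift 3 j).

Lemma ord6P (P : 'I_(3 + 3) -> Prop) :
  (forall j, P (lshift 3 j)) -> (forall j, P (rshift 3 j)) -> forall k, P k.
Proof. by move=> Pl Pr k; case: (splitP k) => j e;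
  [have -> : k = lshift 3 j by exact: val_inj|have -> : k = rshift 3 j by exact: val_inj]. Qed.

Lemma row6P v w : (forall j, xc j v = xc j w) -> (forall j, yc j v = yc j w) ->
  v = w.
Proof. by move=> hx hy; apply/rowP; apply: ord6P. Qed.

Lemma xcD j v w : xc j (v + w) = xc j v + xc j w. Proof. by rewrite /xc mxE. Qed.
Lemma ycD j v w : yc j (v + w) = yc j v + yc j w. Proof. by rewrite /yc mxE. Qed.
Lemma xcZ j a v : xc j (a *: v) = a * xc j v. Proof. by rewrite /xc mxE. Qed.
Lemma ycZ j a v : yc j (a *: v) = a * yc j v. Proof. by rewrite /yc mxE. Qed.

Lemma xcC3 (a b c : R[i]) :
  (xc o0 (C3 a b c) = complex.Re a) * (xc o1 (C3 a b c) = complex.Re b)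
  * (xc o2 (C3 a b c) = complex.Re c).
Proof. by rewrite /xc /C3 /cvec !row_mxEl !mxE. Qed.

Lemma ycC3 (a b c : R[i]) :
  (yc o0 (C3 a b c) = complex.Im a) * (yc o1 (C3 a b c) = complex.Im b)
  * (yc o2 (C3 a b c) = complex.Im c).
Proof. by rewrite /yc /C3 /cvec !row_mxEr !mxE. Qed.

Lemma z1E p : z1 p = xc o0 p +i* yc o0 p. Proof. by []. Qed.
Lemma z2E p : z2 p = xc o1 p +i* yc o1 p. Proof. by []. Qed.
Lemma z3E p : z3 p = xc o2 p +i* yc o2 p. Proof. by []. Qed.

Lemma dotvE v w : dotv v w =
  xc o0 v * xc o0 w + xc o1 v * xc o1 w + xc o2 v * xc o2 w
  + (yc o0 v * yc o0 w + yc o1 v * yc o1 w + yc o2 v * yc o2 w).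
Proof. by rewrite /dotv big_split_ord /= !sum_ord3. Qed.

Definition Jv v : 'rV[R]_(3 + 3) :=
  C3 (- yc o0 v +i* xc o0 v) (- yc o1 v +i* xc o1 v) (- yc o2 v +i* xc o2 v).

Lemma omega0E v w : omega0 v w = dotv (Jv v) w.
Proof.
rewrite /omega0 sum_ord3 dotvE /Jv !xcC3 !ycC3 /=.
rewrite -!/(xc _ _) -!/(yc _ _); ring.
Qed.

Definition re12 p := xc o0 p * xc o1 p - yc o0 p * yc o1 p.
Definition im12 p := xc o0 p * yc o1 p + yc o0 p * xc o1 p.

(* [tv1] and [tv2] generate the action; [tv3] is the conjugate of
   e^(i Im z_3) (z_2, z_1, z_1 z_2). The normal [nv] is i times the tangent [tv]. *)
Definition tv1 p : 'rV[R]_(3 + 3) :=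
  C3 (- yc o0 p +i* xc o0 p) 0 (0 +i* -1).
Definition tv2 p : 'rV[R]_(3 + 3) :=
  C3 0 (- yc o1 p +i* xc o1 p) (0 +i* -1).
Definition tv3 p : 'rV[R]_(3 + 3) :=
  let C := cos (yc o2 p) in let S := sin (yc o2 p) in
  C3 ((C * xc o1 p - S * yc o1 p) +i* - (C * yc o1 p + S * xc o1 p))
     ((C * xc o0 p - S * yc o0 p) +i* - (C * yc o0 p + S * xc o0 p))
     ((C * re12 p - S * im12 p) +i* - (C * im12 p + S * re12 p)).

Definition nv1 p : 'rV[R]_(3 + 3) :=
  C3 (- xc o0 p +i* - yc o0 p) 0 (1 +i* 0).
Definition nv2 p : 'rV[R]_(3 + 3) :=
  C3 0 (- xc o1 p +i* - yc o1 p) (1 +i* 0).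
Definition nv3 p : 'rV[R]_(3 + 3) :=
  let C := cos (yc o2 p) in let S := sin (yc o2 p) in
  C3 ((C * yc o1 p + S * xc o1 p) +i* (C * xc o1 p - S * yc o1 p))
     ((C * yc o0 p + S * xc o0 p) +i* (C * xc o0 p - S * yc o0 p))
     ((C * im12 p + S * re12 p) +i* (C * re12 p - S * im12 p)).

Definition tframe p : 'M[R]_(3, 3 + 3) := \matrix_(a < 3) [:: tv1 p; tv2 p; tv3 p]`_a.
Definition nframe p : 'M[R]_(3, 3 + 3) := \matrix_(a < 3) [:: nv1 p; nv2 p; nv3 p]`_a.

Definition nsq1 p := xc o0 p ^+ 2 + yc o0 p ^+ 2.
Definition nsq2 p := xc o1 p ^+ 2 + yc o1 p ^+ 2.
Definition gdet p := nsq1 p * nsq2 p + nsq1 p + nsq2 p.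

(** The gradient of Im (z_1 z_2 e^(z_3)) is divided by e^(Re z_3) in [nv3]. This makes the squared
    length of the third vector equal to (|z_1|^2 + 1)(|z_2|^2 + 1) - 1, the determinant of the upper
    left block, so the inverse has one common denominator. *)
Definition gram p : 'M[R]_3 :=
  \matrix_(i < 3, j < 3) (nth [::] [:: [:: nsq1 p + 1; 1; 0]; [:: 1; nsq2 p + 1; 0];
     [:: 0; 0; gdet p]] i)`_j.
Definition igram p : 'M[R]_3 := (gdet p)^-1 *:
  \matrix_(i < 3, j < 3) (nth [::] [:: [:: nsq2 p + 1; -1; 0]; [:: -1; nsq1 p + 1; 0];
     [:: 0; 0; 1]] i)`_j.

Lemma mulmx_trE (A B : 'M[R]_(3, 3 + 3)) i j :
  (A *m B^T) i j = dotv (row i A) (row j B).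
Proof. by rewrite !mxE /dotv; apply: eq_bigr => k _; rewrite !mxE. Qed.

Lemma row_tframe p : (row o0 (tframe p) = tv1 p) * (row o1 (tframe p) = tv2 p)
  * (row o2 (tframe p) = tv3 p).
Proof. by rewrite /tframe !rowK. Qed.

Lemma row_nframe p : (row o0 (nframe p) = nv1 p) * (row o1 (nframe p) = nv2 p)
  * (row o2 (nframe p) = nv3 p).
Proof. by rewrite /nframe !rowK. Qed.

Lemma cosx2 t : cos t ^+ 2 = 1 - sin t ^+ 2 :> R.
Proof. by rewrite -(cos2Dsin2 t) addrK. Qed.

(** The last identity says that the components of [mu] Poisson-commute: pairing a tangent vector
    with i times another one is [omega0] up to sign. *)
Lemma frame_gram p : [/\ tframe p *m (tframe p)^T = gram p,
  nframe p *m (nframe p)^T = gram p & tframe p *m (nframe p)^T = 0].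
Proof.
have cs := cosx2 (yc o2 p).
by split; apply/matrixP; apply: ord3P; apply: ord3P;
  rewrite mulmx_trE ?(row_tframe, row_nframe) mxE /= dotvE /tv1 /tv2 /tv3 /nv1 /nv2 /nv3
    !xcC3 !ycC3 /= /gdet /nsq1 /nsq2 /re12 /im12; ring: cs.
Qed.

Lemma gdet_gt0 p : (z1 p, z2 p) <> (0, 0) -> 0 < gdet p.
Proof.
move=> nz; have n1 : 0 <= nsq1 p by rewrite addr_ge0 ?sqr_ge0.
have n2 : 0 <= nsq2 p by rewrite addr_ge0 ?sqr_ge0.
have n12 : 0 <= nsq1 p * nsq2 p by exact: mulr_ge0.
suff : 0 < nsq1 p + nsq2 p by rewrite /gdet; lra.
rewrite lt_neqAle addr_ge0 // andbT; apply/negP; rewrite eq_sym paddr_eq0 //.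
rewrite !paddr_eq0 ?sqr_ge0 // !sqrf_eq0 => /andP[/andP[/eqP a /eqP b] /andP[/eqP c /eqP d]].
by apply: nz; rewrite z1E z2E a b c d.
Qed.

Lemma gram_igram p : (z1 p, z2 p) <> (0, 0) -> gram p *m igram p = 1%:M.
Proof.
move=> /gdet_gt0 g0; have g0' : gdet p != 0 by rewrite gt_eqF.
apply/matrixP; apply: ord3P; apply: ord3P;
  rewrite mxE sum_ord3 /igram /gram !mxE /=; move: g0'; rewrite /gdet => g0'; field.
all: try exact: g0'.
Qed.

(** The Gram identities give a right inverse of the two frames stacked into a square matrix. It is
    also a left inverse, and that product is the decomposition into tangential and normal
    projections. *)
Lemma frame_complete p : (z1 p, z2 p) <> (0, 0) ->
  (tframe p)^T *m igram p *m tframe p + (nframe p)^T *m igram p *m nframe p = 1%:M.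
Proof.
move=> nz; have GG := gram_igram nz; have [tt nn tn] := frame_gram p.
have nt : nframe p *m (tframe p)^T = 0.
  by rewrite -[LHS]trmxK trmx_mul trmxK tn trmx0.
pose B : 'M[R]_(3 + 3) := col_mx (tframe p) (nframe p).
pose B' : 'M[R]_(3 + 3) := row_mx ((tframe p)^T *m igram p) ((nframe p)^T *m igram p).
have : B *m B' = 1%:M.
  by rewrite mul_col_row !mulmxA tt nn tn nt GG !mul0mx -scalar_mx_block.
by move/mulmx1C; rewrite mul_row_col.
Qed.

Lemma trmx_igram p : (igram p)^T = igram p.
Proof. by apply/matrixP; apply: ord3P; apply: ord3P; rewrite !mxE. Qed.

(** * An arbitrary tangent basis compared with the explicit one *)

Section TangentFrame.
Variables (p : 'rV[R]_(3 + 3)) (D : 'M[R]_(3, 3 + 3)).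
Hypotheses (nz : (z1 p, z2 p) <> (0, 0)) (DN : D *m (nframe p)^T = 0)
  (Dfree : row_free D).

Lemma tangentE m (A : 'M[R]_(m, 3 + 3)) : A *m (nframe p)^T = 0 ->
  A = A *m (tframe p)^T *m igram p *m tframe p.
Proof.
move=> AN; rewrite -[LHS]mulmx1 -(frame_complete nz) mulmxDr.
by rewrite !mulmxA AN !mul0mx addr0.
Qed.

Definition chg : 'M[R]_3 := D *m (tframe p)^T *m igram p.

Lemma chgE : D = chg *m tframe p.
Proof. exact: tangentE. Qed.

Lemma chg_unit : chg \in unitmx.
Proof.
rewrite -row_free_unit /row_free eqn_leq rank_leq_row /=.
by rewrite -{1}(eqP Dfree) {1}chgE mxrankM_maxl.
Qed.

Lemma gram_unit : gram p \in unitmx.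
Proof. by have /mulmx1_unit[] := gram_igram nz. Qed.

Lemma metric_chg : D *m D^T = chg *m gram p *m chg^T.
Proof. by have [<- _ _] := frame_gram p; rewrite {1 2}chgE trmx_mul !mulmxA. Qed.

Lemma metric_unit : D *m D^T \in unitmx.
Proof. by rewrite metric_chg 2!unitmx_mul unitmx_tr chg_unit gram_unit. Qed.

(** With D = chg T the invertible factor [chg] cancels from the projector. This is the passage from
    an arbitrary chart to the explicit frame. *)
Lemma tangent_proj : D^T *m invmx (D *m D^T) *m D = (tframe p)^T *m igram p *m tframe p.
Proof.
have uT : chg^T \in unitmx by rewrite unitmx_tr chg_unit.
have -> : invmx (D *m D^T) = invmx chg^T *m igram p *m invmx chg.
  set X := RHS; have DX : D *m D^T *m X = 1%:M.
    rewrite metric_chg /X !mulmxA mulmxK // -(mulmxA chg) gram_igram // mulmx1.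
    exact: mulmxV chg_unit.
  by rewrite -[LHS]mulmx1 -DX mulKmx // metric_unit.
have -> : D^T = (tframe p)^T *m chg^T by rewrite -trmx_mul -chgE.
rewrite !mulmxA mulmxK //.
by rewrite -[LHS]mulmxA [X in _ *m X](_ : _ = tframe p) // [X in _ *m X]chgE mulKmx // chg_unit.
Qed.

End TangentFrame.
End Frames.

(** * Differentials computed by following the syntax of a formula *)

Section DiffRules.
Variables (R : realType) (U : normedModType R).
Implicit Types (f g : U -> R) (p : U).

(** These rules are stated for explicit lambda-terms, on which application by syntax can compute the
    differential of a written formula. *)
Lemma is_diff_addf p f g df dg : is_diff p f df -> is_diff p g dg ->
  is_diff p (fun q => f q + g q) (fun v => df v + dg v).
Proof. by move=> ? ?; exact: is_diffD. Qed.

Lemma is_diff_oppf p f df : is_diff p f df ->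
  is_diff p (fun q => - f q) (fun v => - df v).
Proof. by move=> ?; exact: is_diffN. Qed.

Lemma is_diff_mulf p f g df dg : is_diff p f df -> is_diff p g dg ->
  is_diff p (fun q => f q * g q) (fun v => df v * g p + f p * dg v).
Proof.
move=> ? ?; apply: is_diff_eq; apply/funext => v.
by rewrite addrC mulrC.
Qed.

Lemma is_diff_ext p f g df : f =1 g -> is_diff p g df -> is_diff p f df.
Proof. by move=> /funext ->. Qed.

Lemma is_diff_cstf p (c : R) : is_diff p (fun=> c) (fun=> 0).
Proof. exact: is_diff_cst. Qed.

Lemma is_diff_compf p f df (h : R -> R) (dh : R) : is_derive (f p) 1 h dh ->
  is_diff p f df -> is_diff p (fun q => h (f q)) (fun v => dh * df v).
Proof.
move=> [hd hE] dfp.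
have dh1 : differentiable h (f p) by apply/derivable1_diffP.
have dhp : is_diff (f p) h (fun t => dh * t).
  apply: DiffDef => //; apply/funext => t; rewrite diff1E // derive1E hE.
  by rewrite mulrC.
exact: (@is_diff_comp _ _ _ _ f df h (fun t => dh * t)).
Qed.

Lemma is_diff_coord n (p : 'rV[R]_n) j : is_diff p (fun q => q 0 j) (fun v => v 0 j).
Proof.
have lf : linear (fun N : 'rV[R]_n => N 0 j : R).
  by move=> a u v; rewrite !mxE.
pose fM := GRing.isLinear.Build _ _ _ _ _ lf.
pose fL : {linear 'rV[R]_n -> R} := HB.pack (fun N : 'rV[R]_n => N 0 j : R) fM.
apply: DiffDef; first exact: differentiable_coord.
rewrite (_ : (fun q : 'rV[R]_n => q 0 j) = fL) // diff_lin //.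
exact: coord_continuous.
Qed.

Lemma differentiable_rV n (f : U -> 'rV[R]_n) p :
  (forall j, differentiable (fun q => f q 0 j) p) -> differentiable f p.
Proof.
move=> df; have -> : f = \sum_(j < n) (fun q => f q 0 j *: delta_mx 0 j).
  by apply/funext => q; rewrite fct_sumE -row_sum_delta.
by apply: differentiable_sum => j; exact: differentiableZl.
Qed.

Lemma diff_coordE n (f : U -> 'rV[R]_n) p v j : differentiable f p ->
  ('d f p v) 0 j = 'd (fun q => f q 0 j) p v.
Proof.
move=> df; have dc := is_diff_coord (f p) j.
rewrite (_ : (fun q => f q 0 j) = (fun w : 'rV[R]_n => w 0 j) \o f) //.
have dcf : differentiable (fun w : 'rV[R]_n => w 0 j) (f p) by exact: ex_diff.
by rewrite (diff_comp df dcf) /= [in RHS]diff_val.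
Qed.

Lemma is_diff_rV n (f : U -> 'rV[R]_n) p (df : U -> 'rV[R]_n) :
  (forall j, is_diff p (fun q => f q 0 j) (fun v => df v 0 j)) -> is_diff p f df.
Proof.
move=> df1; have dfp : differentiable f p by apply: differentiable_rV => j.
apply: DiffDef => //; apply/funext => v; apply/rowP => j.
by rewrite diff_coordE // diff_val.
Qed.

End DiffRules.

(** * Differentials of [mu] and of the normals *)

Section Moments.
Variable R : realType.
Implicit Types (p v w : 'rV[R]_(3 + 3)).

Lemma is_diff_xc p j : is_diff p (xc j : _ -> R) (xc j).
Proof. exact: is_diff_coord. Qed.

Lemma is_diff_yc p j : is_diff p (yc j : _ -> R) (yc j).
Proof. exact: is_diff_coord. Qed.

Lemma muE p : mu p = vec3 (xc o2 p - 2^-1 * nsq1 p) (xc o2 p - 2^-1 * nsq2 p)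
  (expR (xc o2 p) * (cos (yc o2 p) * im12 p + sin (yc o2 p) * re12 p)).
Proof.
rewrite /mu z1E z2E z3E /cexp /expi /Normc.normc /=.
rewrite !sqr_sqrtr ?addr_ge0 ?sqr_ge0 //.
congr vec3; rewrite /im12 /re12; ring.
Qed.

Let fct0 v : (0 : 'rV[R]_(3 + 3) -> R) v = 0. Proof. by []. Qed.

Definition dmu p v : 'rV[R]_3 := vec3 (dotv (nv1 p) v) (dotv (nv2 p) v)
  (expR (xc o2 p) * dotv (nv3 p) v).

Ltac diff_rules := repeat first
  [ apply: is_diff_xc | apply: is_diff_yc | apply: is_diff_cstf
  | apply: is_diff_addf | apply: is_diff_oppf | apply: is_diff_mulf
  | apply: (is_diff_compf (is_derive_cos _)) | apply: (is_diff_compf (is_derive_sin _))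
  | apply: (is_diff_compf (is_derive_expR _)) ].

Lemma vec3E (a b c : R) : (vec3 a b c 0 o0 = a) * (vec3 a b c 0 o1 = b)
  * (vec3 a b c 0 o2 = c).
Proof. by rewrite /vec3 !mxE. Qed.

Lemma is_diff_mu p : is_diff p (@mu R) (dmu p).
Proof.
apply: is_diff_rV; apply: ord3P.
- apply: (@is_diff_ext _ _ _ _ (fun q => xc o2 q - 2^-1 * (xc o0 q * xc o0 q + yc o0 q * yc o0 q))).
    by move=> q; rewrite muE vec3E.
  apply: is_diff_eq; first by diff_rules.
  apply/funext => v; rewrite /dmu vec3E dotvE /nv1 !xcC3 !ycC3 /= ?fct0; by field.
- apply: (@is_diff_ext _ _ _ _ (fun q => xc o2 q - 2^-1 * (xc o1 q * xc o1 q + yc o1 q * yc o1 q))).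
    by move=> q; rewrite muE vec3E.
  apply: is_diff_eq; first by diff_rules.
  apply/funext => v; rewrite /dmu vec3E dotvE /nv2 !xcC3 !ycC3 /= ?fct0; by field.
- apply: (@is_diff_ext _ _ _ _ (fun q => expR (xc o2 q) *
    (cos (yc o2 q) * (xc o0 q * yc o1 q + yc o0 q * xc o1 q)
     + sin (yc o2 q) * (xc o0 q * xc o1 q - yc o0 q * yc o1 q)))).
    by move=> q; rewrite muE vec3E.
  apply: is_diff_eq; first by diff_rules.
  apply/funext => v; rewrite /dmu vec3E dotvE /nv3 !xcC3 !ycC3 /= ?fct0.
  rewrite /im12 /re12; ring.
Qed.

Definition dnv1 v : 'rV[R]_(3 + 3) := C3 (- xc o0 v +i* - yc o0 v) 0 0.
Definition dnv2 v : 'rV[R]_(3 + 3) := C3 0 (- xc o1 v +i* - yc o1 v) 0.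
Definition dnv3 p v : 'rV[R]_(3 + 3) :=
  let C := cos (yc o2 p) in let S := sin (yc o2 p) in let s := yc o2 v in
  let dim := xc o0 v * yc o1 p + xc o0 p * yc o1 v
    + (yc o0 v * xc o1 p + yc o0 p * xc o1 v) in
  let dre := xc o0 v * xc o1 p + xc o0 p * xc o1 v
    - (yc o0 v * yc o1 p + yc o0 p * yc o1 v) in
  C3 ((C * yc o1 v + S * xc o1 v + s * (C * xc o1 p - S * yc o1 p)) +i*
      (C * xc o1 v - S * yc o1 v - s * (C * yc o1 p + S * xc o1 p)))
     ((C * yc o0 v + S * xc o0 v + s * (C * xc o0 p - S * yc o0 p)) +i*
      (C * xc o0 v - S * yc o0 v - s * (C * yc o0 p + S * xc o0 p)))
     ((C * dim + S * dre + s * (C * re12 p - S * im12 p)) +i*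
      (C * dre - S * dim - s * (C * im12 p + S * re12 p))).

Let xcE (q : 'rV[R]_(3 + 3)) j : q 0 (lshift 3 j) = xc j q :> R. Proof. by []. Qed.
Let ycE (q : 'rV[R]_(3 + 3)) j : q 0 (rshift 3 j) = yc j q :> R. Proof. by []. Qed.

Ltac diff_frame := apply: is_diff_rV; apply: ord6P; apply: ord3P;
  (* [reflexivity] instantiates the unknown function with the simplified coordinate formula, whose
     syntax the rules can follow. *)
  (eapply is_diff_ext;
    [move=> q; rewrite ?xcE ?ycE ?xcC3 ?ycC3 /= /im12 /re12; reflexivity|]);
  (apply: is_diff_eq; try solve [diff_rules]);
  apply/funext => v; rewrite ?xcE ?ycE ?xcC3 ?ycC3 /= ?fct0 /im12 /re12; by ring.

Lemma is_diff_nv1 p : is_diff p (@nv1 R) dnv1.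
Proof. rewrite /nv1 /dnv1; diff_frame. Qed.

Lemma is_diff_nv2 p : is_diff p (@nv2 R) dnv2.
Proof. rewrite /nv2 /dnv2; diff_frame. Qed.

Lemma is_diff_nv3 p : is_diff p (@nv3 R) (dnv3 p).
Proof. rewrite /nv3 /dnv3; diff_frame. Qed.

End Moments.

(** * Tangent vectors as the kernel of [dmu], and traces over the tangent space *)

Section Tangency.
Variable R : realType.
Implicit Types (p : 'rV[R]_(3 + 3)).

Lemma is_diff_coordf (U : normedModType R) n (f df : U -> 'rV[R]_n) (p : U) j :
  is_diff p f df -> is_diff p (fun q => f q 0 j) (fun v => df v 0 j).
Proof.
move=> dfp; have dc := is_diff_coord (f p) j.
exact: (@is_diff_comp _ _ _ _ f df (fun w : 'rV[R]_n => w 0 j) (fun v => v 0 j)).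
Qed.

Lemma is_diff_dotv (U : normedModType R) n (f g df dg : U -> 'rV[R]_n) (p : U) :
  is_diff p f df -> is_diff p g dg ->
  is_diff p (fun q => dotv (f q) (g q)) (fun v => dotv (df v) (g p) + dotv (f p) (dg v)).
Proof.
move=> dfp dgp; rewrite /dotv.
have Hi (i : 'I_n) := is_diff_mulf (is_diff_coordf i dfp) (is_diff_coordf i dgp).
have dF : differentiable (\sum_(i < n) (fun q => f q 0 i * g q 0 i)) p.
  by apply: differentiable_sum => i; exact: ex_diff.
have e1 : (fun q => \sum_(i < n) f q 0 i * g q 0 i) =
    \sum_(i < n) (fun q => f q 0 i * g q 0 i).
  by apply/funext => q; rewrite fct_sumE.
rewrite e1; apply: DiffDef => //; apply/funext => v.
rewrite -deriveE // derive_sum => [|i]; last by apply: diff_derivable; exact: ex_diff.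
rewrite -big_split /=; apply: eq_bigr => i _.
by rewrite deriveE ?diff_val.
Qed.

Lemma dotvDl n (v w x : 'rV[R]_n) : dotv (v + w) x = dotv v x + dotv w x.
Proof. by rewrite /dotv -big_split; apply: eq_bigr => i _; rewrite mxE mulrDl. Qed.

Lemma dotvZl n a (v x : 'rV[R]_n) : dotv (a *: v) x = a * dotv v x.
Proof. by rewrite /dotv mulr_sumr; apply: eq_bigr => i _; rewrite mxE mulrA. Qed.

Lemma dotv_sym n (v w : 'rV[R]_n) : dotv v w = dotv w v.
Proof. by rewrite /dotv; apply: eq_bigr => i _; rewrite mulrC. Qed.

Lemma dotv_mx n (v w : 'rV[R]_n) : dotv v w = (v *m w^T) 0 0.
Proof. by rewrite mxE /dotv; apply: eq_bigr => i _; rewrite mxE. Qed.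

Lemma dotv_suml n I (r : seq I) (F : I -> 'rV[R]_n) x :
  dotv (\sum_(i <- r) F i) x = \sum_(i <- r) dotv (F i) x.
Proof.
elim: r => [|i r IH]; last by rewrite !big_cons dotvDl IH.
by rewrite !big_nil /dotv big1 // => i _; rewrite mxE mul0r.
Qed.

Definition frame n N (phi : 'rV[R]_n -> 'rV[R]_N) u : 'M[R]_(n, N) :=
  \matrix_(j < n) partial j phi u.

Section AnyParam.
Variables (n N : nat) (phi : 'rV[R]_n -> 'rV[R]_N) (u : 'rV[R]_n).

Lemma metricE : metric phi u = frame phi u *m (frame phi u)^T.
Proof.
apply/matrixP => i j; rewrite !mxE /dotv; apply: eq_bigr => k _.
by rewrite !mxE.
Qed.

Lemma normal_partE v : normal_part phi u v =
  v - v *m (frame phi u)^T *m invmx (metric phi u) *m frame phi u.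
Proof.
rewrite /normal_part; congr (_ - _).
rewrite mulmx_sum_row exchange_big /=; apply: eq_bigr => j _.
rewrite rowK -scaler_suml mxE; congr (_ *: _).
apply: eq_bigr => i _; rewrite mulrC; congr (_ * _).
by rewrite mxE /dotv; apply: eq_bigr => k _; rewrite !mxE.
Qed.

Lemma diff_frame x : differentiable phi u -> 'd phi u x = x *m frame phi u.
Proof.
move=> dphi; rewrite mulmx_sum_row {1}(row_sum_delta x) linear_sum /=.
by apply: eq_bigr => j _; rewrite linearZ rowK /partial deriveE.
Qed.

Lemma frame_free : differentiable phi u -> injective ('d phi u) ->
  row_free (frame phi u).
Proof.
move=> dphi inj; apply: inj_row_free => x; rewrite -diff_frame // => dx0.
by apply: inj; rewrite dx0 linear0.
Qed.

End AnyParam.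

Lemma smooth_diff (U W : normedModType R) (V : set U) (f : U -> W) u :
  smooth_on V f -> V u -> differentiable f u.
Proof. by move=> sf Vu; have [df _] := sf 1; exact: df. Qed.

Lemma smooth_derive (U W : normedModType R) (V : set U) (f : U -> W) v :
  smooth_on V f -> smooth_on V ('D_v f).
Proof. by move=> sf k; have [_] := sf k.+1; exact. Qed.

Lemma dmu_eq0 p (v : 'rV[R]_(3 + 3)) : dmu p v = 0 <-> v *m (nframe p)^T = 0.
Proof.
have vN : forall i, (v *m (nframe p)^T) 0 i = dotv v (row i (nframe p)).
  by move=> i; rewrite mxE /dotv; apply: eq_bigr => k _; rewrite !mxE.
have e0 : expR (xc o2 p) != 0 by rewrite gt_eqF // expR_gt0.
split=> [d0|/rowP d0].
  have dj j : dmu p v 0 j = 0 by rewrite d0 mxE.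
  have := dj o0; have := dj o1; have := dj o2; rewrite /dmu !vec3E => h2 h1 h0.
  apply/rowP; apply: ord3P; rewrite vN row_nframe mxE dotv_sym //.
  by move/eqP: h2; rewrite mulf_eq0 (negbTE e0) => /eqP.
apply/rowP; apply: ord3P; rewrite [RHS]mxE /dmu vec3E dotv_sym.
- by have := d0 o0; rewrite vN row_nframe mxE.
- by have := d0 o1; rewrite vN row_nframe mxE.
- by have := d0 o2; rewrite vN row_nframe mxE => ->; rewrite mulr0.
Qed.

(** Expand v in the tangent frame. Since i [tv] = [nv], pairing each frame vector with w under
    [omega0] gives the pairing of a normal with w, which is zero. *)
Lemma tangent_isotropic p (v w : 'rV[R]_(3 + 3)) : (z1 p, z2 p) <> (0, 0) ->
  v *m (nframe p)^T = 0 -> w *m (nframe p)^T = 0 -> omega0 v w = 0.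
Proof.
move=> nz vN wN; have -> := tangentE nz vN.
set al := v *m _ *m _; rewrite mulmx_sum_row sum_ord3 !row_tframe.
have wi i : dotv (row i (nframe p)) w = 0.
  have /rowP/(_ i) := wN; rewrite !mxE => <-.
  by rewrite dotv_sym /dotv; apply: eq_bigr => k _; rewrite !mxE.
have := (wi o0, wi o1, wi o2); rewrite !row_nframe => -[[h0 h1] h2].
have -> : omega0 (al 0 o0 *: tv1 p + al 0 o1 *: tv2 p + al 0 o2 *: tv3 p) w =
  al 0 o0 * dotv (nv1 p) w + al 0 o1 * dotv (nv2 p) w + al 0 o2 * dotv (nv3 p) w.
  rewrite omega0E !dotvE /Jv /tv1 /tv2 /tv3 /nv1 /nv2 /nv3 !(xcC3, ycC3, xcD, ycD, xcZ, ycZ) /=.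
  by ring.
by rewrite h0 h1 h2 !mulr0 !addr0.
Qed.

Lemma xc_e3 : (xc o0 (e3 R) = 0) * (xc o1 (e3 R) = 0) * (xc o2 (e3 R) = 1)
 * (yc o0 (e3 R) = 0) * (yc o1 (e3 R) = 0) * (yc o2 (e3 R) = 0).
Proof. by rewrite /e3 !xcC3 !ycC3. Qed.

(** The trace over the tangent space of the form (x, y) |-> <B x, y>, read in the explicit frame. *)
Definition trace_form p (B : 'rV[R]_(3 + 3) -> 'rV[R]_(3 + 3)) : R :=
  \sum_(b < 3) \sum_(c < 3) igram p b c * dotv (B (row b (tframe p))) (row c (tframe p)).

(** This is the soliton equation tested on each normal, and it is where the constants in the action
    enter. For [dnv1] only the first coordinate contributes, giving -((|z_2|^2 + 1) |z_1|^2 +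
    |z_2|^2) / gdet = -1, while [e3] pairs to 1 with [nv1]. *)
Lemma trace_dnv p : (z1 p, z2 p) <> (0, 0) ->
  [/\ trace_form p (@dnv1 R) = - dotv (e3 R) (nv1 p),
      trace_form p (@dnv2 R) = - dotv (e3 R) (nv2 p)
    & trace_form p (dnv3 p) = - dotv (e3 R) (nv3 p)].
Proof.
move=> /gdet_gt0 g0; have g0' : gdet p != 0 by rewrite gt_eqF.
have cs := cosx2 (yc o2 p).
rewrite /trace_form !sum_ord3 /igram !mxE /= !row_tframe !dotvE !xc_e3.
rewrite /tv1 /tv2 /tv3 /dnv1 /dnv2 /dnv3 /nv1 /nv2 /nv3 !(xcC3, ycC3) /=.
move: g0'; rewrite /gdet /nsq1 /nsq2 /re12 /im12.
move: cs; set C := cos _; set S := sin _.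
move: (xc o0 p) (xc o1 p) (yc o0 p) (yc o1 p) => x1 x2 y1 y2 cs g0'.
split.
- by field: cs.
- by field: cs.
- by field: cs.
Qed.

End Tangency.

(** * The soliton equation in an arbitrary chart *)

Section Soliton.
Variable R : realType.
Variables (a b c : R) (V : set 'rV[R]_3) (phi : 'rV[R]_3 -> 'rV[R]_(3 + 3)).
Hypothesis lp : local_param (smooth_part (fibre a b c)) V phi.

Let L := smooth_part (fibre a b c).

(** That phi maps V into L is contained in the homeomorphism clause, taken for W = V. *)
Lemma param_mem u : V u -> L (phi u).
Proof.
move=> Vu; have [U oU e] := lp_homeo lp (lp_open lp) (@subset_refl _ V).
by have : (phi @` V) (phi u); [exists u|rewrite e => -[]].
Qed.

Lemma param_nz u : V u -> (z1 (phi u), z2 (phi u)) <> (0, 0).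
Proof. by move=> /param_mem[]. Qed.

Lemma param_diff u : V u -> differentiable phi u.
Proof. exact: smooth_diff (lp_smooth lp). Qed.

Lemma partial_diff i u : V u -> differentiable (partial i phi) u.
Proof. apply: smooth_diff; exact/smooth_derive/(lp_smooth lp). Qed.

(** The composite of [mu] with phi is constant on the open set V, so its differential vanishes. *)
Lemma param_tangent u v : V u -> 'd phi u v *m (nframe (phi u))^T = 0.
Proof.
move=> Vu; apply/dmu_eq0.
have dphi := differentiableP (param_diff Vu).
have dm := is_diff_mu (phi u).
have dmp : is_diff u (@mu R \o phi) (dmu (phi u) \o 'd phi u).
  exact: is_diff_comp.
have <- : 'd (@mu R \o phi) u v = dmu (phi u) ('d phi u v) by rewrite diff_val.
rewrite -deriveE; last exact: ex_diff.
rewrite (@near_eq_derive _ _ _ _ (cst (vec3 a b c))) ?derive_cst //.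
by apply: (open_near_eq (lp_open lp) Vu) => w /param_mem[].
Qed.

Lemma frame_tangent u : V u -> frame phi u *m (nframe (phi u))^T = 0.
Proof.
move=> Vu; apply/row_matrixP => i; rewrite row_mul rowK row0.
rewrite /partial deriveE; last exact: param_diff.
exact: param_tangent.
Qed.

Lemma frame_row_free u : V u -> row_free (frame phi u).
Proof. by move=> Vu; apply: frame_free; [exact: param_diff|exact: (lp_immersion lp)]. Qed.

Lemma second_derivative_normal (nv : 'rV[R]_(3 + 3) -> 'rV[R]_(3 + 3)) dnv u i j : V u ->
  is_diff (phi u) nv dnv ->
  (forall w, V w -> forall j, dotv (partial j phi w) (nv (phi w)) = 0) ->
  dotv (partial i (partial j phi) u) (nv (phi u))
    = - dotv (partial j phi u) (dnv (partial i phi u)).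
Proof.
move=> Vu dn0 orth; have dphi := differentiableP (param_diff Vu).
have ddphi := differentiableP (partial_diff j Vu).
have dn := is_diff_comp dphi dn0.
have dF := is_diff_dotv ddphi dn.
have e0 : 'D_(delta_mx 0 i) (fun w => dotv (partial j phi w) ((nv \o phi) w)) u = 0.
  rewrite (@near_eq_derive _ _ _ _ (cst (0 : R))) ?derive_cst //.
  by apply: (open_near_eq (lp_open lp) Vu) => w Vw; exact: orth.
move: e0; rewrite deriveE; last exact: (@ex_diff _ _ _ _ _ _ _ dF).
rewrite (@diff_val _ _ _ _ _ _ _ dF) /=.
move/eqP; rewrite addr_eq0 => /eqP.
have -> : partial i (partial j phi) u = 'd (partial j phi) u (delta_mx 0 i).
  by apply: deriveE; exact: partial_diff.
have -> : partial i phi u = 'd phi u (delta_mx 0 i).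
  by apply: deriveE; exact: param_diff.
exact.
Qed.

(** Subtracting the chart-independent tangential projector from the identity leaves the projector on
    the explicit normals. *)
Lemma normal_part_nframe u v : V u -> normal_part phi u v =
  v *m (nframe (phi u))^T *m igram (phi u) *m nframe (phi u).
Proof.
move=> Vu; have nz := param_nz Vu.
rewrite normal_partE metricE.
have -> : v *m (frame phi u)^T *m invmx (frame phi u *m (frame phi u)^T) *m frame phi u
  = v *m ((tframe (phi u))^T *m igram (phi u) *m tframe (phi u)).
  by rewrite -(tangent_proj nz (frame_tangent Vu) (frame_row_free Vu)) !mulmxA.
rewrite -[X in X - _](mulmx1 v) -mulmxBr -(frame_complete nz).
by rewrite addrAC subrr add0r !mulmxA.
Qed.

(** By cyclicity both sides are the trace of B times a tangential projector D^T G D, and the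
    projector does not see the basis. *)
Lemma trace_metric (B : 'M[R]_(3 + 3)) u : V u ->
  \sum_(i < 3) \sum_(j < 3) inv_metric phi u i j *
     dotv (partial j phi u) (partial i phi u *m B)
  = trace_form (phi u) (mulmxr B).
Proof.
move=> Vu; have nz := param_nz Vu.
have tr_sum (G : 'M[R]_3) (D : 'M[R]_(3, 3 + 3)) : G^T = G ->
    \sum_(i < 3) \sum_(j < 3) G i j * dotv (row i D *m B) (row j D) = \tr (D^T *m G *m D *m B).
  move=> GT; transitivity (\tr (G *m (D *m B *m D^T)^T)).
    apply: eq_bigr => i _; rewrite mxE; apply: eq_bigr => j _.
    by rewrite [in RHS]mxE mulmx_trE row_mul.
  rewrite -mxtrace_tr trmx_mul trmxK GT -[X in \tr X]mulmxA mxtrace_mulC.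
  by rewrite !mulmxA.
rewrite /trace_form tr_sum ?trmx_igram //.
rewrite -(tangent_proj nz (frame_tangent Vu) (frame_row_free Vu)) -metricE -tr_sum.
  apply: eq_bigr => i _; apply: eq_bigr => j _.
  by rewrite !rowK dotv_sym.
by rewrite trmx_inv metricE trmx_mul trmxK.
Qed.

Lemma trace_second_normal (nv : 'rV[R]_(3 + 3) -> 'rV[R]_(3 + 3)) dnv u : V u ->
  is_diff (phi u) nv dnv ->
  (forall w, V w -> forall j, dotv (partial j phi w) (nv (phi w)) = 0) ->
  trace_form (phi u) dnv = - dotv (e3 R) (nv (phi u)) ->
  \sum_(i < 3) \sum_(j < 3) inv_metric phi u i j *
     dotv (partial i (partial j phi) u) (nv (phi u)) = dotv (e3 R) (nv (phi u)).
Proof.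
move=> Vu dn0 orth tr.
have dnE x : dnv x = x *m lin1_mx ('d nv (phi u)).
  by rewrite mul_rV_lin1 diff_val.
rewrite -[RHS]opprK -tr.
have -> : trace_form (phi u) dnv = trace_form (phi u) (mulmxr (lin1_mx ('d nv (phi u)))).
  by congr trace_form; apply/funext => x; rewrite /= dnE.
rewrite -(trace_metric _ Vu) -sumrN; apply: eq_bigr => i _.
rewrite -sumrN; apply: eq_bigr => j _; rewrite -mulrN; congr (_ * _).
by rewrite (second_derivative_normal i j Vu dn0 orth) dnE.
Qed.

Lemma soliton_equation u : V u -> mean_curvature phi u = normal_part phi u (e3 R).
Proof.
move=> Vu; have nz := param_nz Vu; have [t1 t2 t3] := trace_dnv nz.
rewrite normal_part_nframe // /mean_curvature.
(* The mean curvature is the normal part of X, so it suffices that X and [e3] have the same pairing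
   with each normal. *)
pose X := \sum_(i < 3) \sum_(j < 3) inv_metric phi u i j *: partial i (partial j phi) u.
transitivity (X *m (nframe (phi u))^T *m igram (phi u) *m nframe (phi u)).
  rewrite -!mulmxA mulmx_suml; apply: eq_bigr => i _.
  rewrite mulmx_suml; apply: eq_bigr => j _.
  by rewrite normal_part_nframe // -scalemxAl !mulmxA.
congr (_ *m _ *m _).
have Xd w : dotv X w = \sum_(i < 3) \sum_(j < 3) inv_metric phi u i j *
     dotv (partial i (partial j phi) u) w.
  rewrite dotv_suml; apply: eq_bigr => i _.
  by rewrite dotv_suml; apply: eq_bigr => j _; rewrite dotvZl.
have vN (v : 'rV[R]_(3 + 3)) i : (v *m (nframe (phi u))^T) 0 i = dotv v (row i (nframe (phi u))).
  by rewrite mxE /dotv; apply: eq_bigr => k _; rewrite !mxE.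
have orth w : V w -> forall i j, dotv (partial j phi w) (row i (nframe (phi w))) = 0.
  move=> Vw i j; have /matrixP/(_ j i) := frame_tangent Vw.
  by rewrite mulmx_trE rowK mxE.
apply/rowP; apply: ord3P; rewrite !vN row_nframe Xd.
- apply: (trace_second_normal Vu (is_diff_nv1 _)) => // w Vw j.
  by have := orth w Vw o0 j; rewrite row_nframe.
- apply: (trace_second_normal Vu (is_diff_nv2 _)) => // w Vw j.
  by have := orth w Vw o1 j; rewrite row_nframe.
- apply: (trace_second_normal Vu (is_diff_nv3 _)) => // w Vw j.
  by have := orth w Vw o2 j; rewrite row_nframe.
Qed.

End Soliton.

(** * The Laplacian of a linear function on a parametrized submanifold *)

Section LaplaceBeltrami.
Variable R : realType.

Lemma derive_coord (U : normedModType R) n (f : U -> 'rV[R]_n) x v j :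
  differentiable f x -> ('D_v f x) 0 j = 'D_v (fun q => f q 0 j) x.
Proof.
move=> df; rewrite deriveE // diff_coordE // deriveE //.
have dfP := is_diff_coordf j (differentiableP df).
exact: (@ex_diff _ _ _ _ _ _ _ dfP).
Qed.

Lemma Ck_coord (U : normedModType R) (V : set U) k n (f : U -> 'rV[R]_n) j :
  open V -> Ck k V f -> Ck k V (fun x => f x 0 j).
Proof.
have lf : linear (fun N : 'rV[R]_n => N 0 j : R) by move=> a u v; rewrite !mxE.
pose fM := GRing.isLinear.Build _ _ _ _ _ lf.
pose fL : {linear 'rV[R]_n -> R} := HB.pack (fun N : 'rV[R]_n => N 0 j : R) fM.
move=> oV; apply: (@Ck_linear _ _ _ _ _ fL) => //.
exact: coord_continuous.
Qed.

Variables (n N : nat) (V : set 'rV[R]_n) (phi : 'rV[R]_n -> 'rV[R]_N).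
Hypotheses (oV : open V) (sphi : smooth_on V phi).

Let dphi u : V u -> differentiable phi u.
Proof. exact: smooth_diff. Qed.

Let ddphi i u : V u -> differentiable (partial i phi) u.
Proof. apply: smooth_diff; exact: smooth_derive. Qed.

Lemma partial_sym i j u : V u -> partial i (partial j phi) u = partial j (partial i phi) u.
Proof.
move=> Vu; apply/rowP => m; rewrite /partial.
have e (v w : 'rV[R]_n) : ('D_v ('D_w phi) u) 0 m = 'D_v ('D_w (fun q => phi q 0 m)) u.
  have dw : differentiable ('D_w phi) u by apply: smooth_diff Vu; exact: smooth_derive.
  rewrite derive_coord //; apply: near_eq_derive.
  by apply: (open_near_eq oV Vu) => y Vy; rewrite derive_coord //; exact: dphi.
refine (etrans (e _ _) (etrans _ (esym (e _ _)))).
by apply: (schwarz _ _ oV) Vu; exact: Ck_coord.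
Qed.

Lemma partial_dotv (f g : 'rV[R]_n -> 'rV[R]_N) i u :
  differentiable f u -> differentiable g u ->
  partial i (fun w => dotv (f w) (g w)) u =
  dotv (partial i f u) (g u) + dotv (f u) (partial i g u).
Proof.
move=> df dg; have dF := is_diff_dotv (differentiableP df) (differentiableP dg).
rewrite /partial deriveE; last exact: (@ex_diff _ _ _ _ _ _ _ dF).
by rewrite (@diff_val _ _ _ _ _ _ _ dF) !deriveE.
Qed.

Lemma partial_metric i j l u : V u ->
  partial i (fun w => metric phi w j l) u =
  dotv (partial i (partial j phi) u) (partial l phi u)
  + dotv (partial j phi u) (partial i (partial l phi) u).
Proof.
move=> Vu; rewrite -partial_dotv; [|exact: ddphi|exact: ddphi].
by congr (partial i _ u); apply/funext => w; rewrite mxE.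
Qed.

Let koszul (pij pji pil pli pjl plj pi pj pl : 'rV[R]_N) :
  pji = pij -> pli = pil -> plj = pjl ->
  2^-1 * (dotv pij pl + dotv pj pil + (dotv pji pl + dotv pi pjl)
          - (dotv pli pj + dotv pi plj)) = dotv pij pl.
Proof. by move=> -> -> ->; rewrite (dotv_sym pil); field. Qed.

(** In the Koszul combination, symmetry of second derivatives cancels everything except twice one
    pairing. *)
Lemma christoffelE k i j u : V u -> christoffel phi k i j u =
  \sum_(l < n) inv_metric phi u k l * dotv (partial i (partial j phi) u) (partial l phi u).
Proof.
move=> Vu; rewrite /christoffel /= mulr_sumr; apply: eq_bigr => l _.
rewrite mulrCA; congr (_ * _); rewrite !partial_metric //.
exact: koszul (partial_sym j i Vu) (partial_sym l i Vu) (partial_sym l j Vu).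
Qed.

Lemma inv_metric_sym u k l : inv_metric phi u k l = inv_metric phi u l k.
Proof.
have e : (inv_metric phi u)^T = inv_metric phi u.
  by rewrite /inv_metric trmx_inv metricE trmx_mul trmxK.
by rewrite -{1}e mxE.
Qed.

Lemma partial_linear j (v : 'rV[R]_N) w : differentiable phi w ->
  partial j (fun q => dotv (phi q) v) w = dotv (partial j phi w) v.
Proof.
move=> dw; rewrite (@partial_dotv phi (cst v)) //.
rewrite [in X in _ + X]/partial derive_cst.
by rewrite [X in _ + X]/dotv big1 ?addr0 // => i _; rewrite mxE mulr0.
Qed.

(** The Christoffel term removes from the second derivative of phi exactly its tangential part, so
    the covariant Hessian of a linear function is the second fundamental form paired with v. *)
Lemma laplacian_linear (v : 'rV[R]_N) u : V u ->
  laplacian phi (fun q => dotv (phi q) v) u = dotv (mean_curvature phi u) v.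
Proof.
move=> Vu; rewrite /laplacian /mean_curvature dotv_suml; apply: eq_bigr => i _.
rewrite dotv_suml; apply: eq_bigr => j _; rewrite dotvZl; congr (_ * _).
have -> : partial i (partial j (fun q => dotv (phi q) v)) u =
    dotv (partial i (partial j phi) u) v.
  rewrite {1}/partial (@near_eq_derive _ _ _ _ (fun q => dotv (partial j phi q) v)).
    rewrite -/(partial i _ u) (@partial_dotv (partial j phi) (cst v)) //; last exact: ddphi.
    rewrite [in X in _ + X]/partial derive_cst.
    by rewrite [X in _ + X]/dotv big1 ?addr0 // => k _; rewrite mxE mulr0.
  by apply: (open_near_eq oV Vu) => y Vy; apply: partial_linear; exact: dphi.
rewrite /normal_part dotvDl; congr (_ + _).
have dN w : dotv (- w) v = - dotv w v by rewrite -scaleN1r dotvZl mulN1r.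
rewrite dN; congr (- _).
rewrite exchange_big dotv_suml; apply: eq_bigr => k _.
rewrite christoffelE // partial_linear; last exact: dphi.
rewrite mulr_suml dotv_suml; apply: eq_bigr => l _.
by rewrite dotvZl inv_metric_sym.
Qed.

(** Only first derivatives matter; this allows an angle known merely up to locally constant terms to
    be replaced by a linear function. *)
Lemma eq_laplacian (f g : 'rV[R]_n -> R) u : V u ->
  (forall k w, V w -> partial k f w = partial k g w) ->
  laplacian phi f u = laplacian phi g u.
Proof.
move=> Vu fg; rewrite /laplacian; apply: eq_bigr => i _; apply: eq_bigr => j _.
have e1 : partial i (partial j f) u = partial i (partial j g) u.
  by apply: near_eq_derive; apply: (open_near_eq oV Vu) => w Vw; exact: fg.
have e2 : \sum_(k < n) christoffel phi k i j u * partial k f u =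
    \sum_(k < n) christoffel phi k i j u * partial k g u.
  by apply: eq_bigr => k _; rewrite (fg k u Vu).
by rewrite e1 e2.
Qed.

End LaplaceBeltrami.

(** * Determinants and restriction of charts *)

Lemma det_mx33 (K : comNzRingType) (A : 'M[K]_3) : \det A =
  A o0 o0 * (A o1 o1 * A o2 o2 - A o1 o2 * A o2 o1)
  - A o0 o1 * (A o1 o0 * A o2 o2 - A o1 o2 * A o2 o0)
  + A o0 o2 * (A o1 o0 * A o2 o1 - A o1 o1 * A o2 o0).
Proof.
(* Indexing the entries by natural numbers makes equal entries syntactically equal for [ring],
   whatever the proofs of the bounds. *)
pose f i j := A (inord i) (inord j).
have fE i j : A i j = f i j by rewrite /f !inord_val.
have -> : A = \matrix_(i, j) f i j by apply/matrixP => i j; rewrite mxE fE.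
rewrite !(expand_det_row _ ord0) !big_ord_recl big_ord0 /cofactor.
rewrite !(expand_det_row _ ord0) !big_ord_recl !big_ord0 /cofactor.
rewrite !det_mx11 !mxE /= /bump /=.
by rewrite ?addn0 ?add0n; ring.
Qed.

Lemma det_gram (R : realType) (p : 'rV[R]_(3 + 3)) : \det (gram p) = gdet p ^+ 2.
Proof. by rewrite det_mx33 /gram !mxE /= /gdet; ring. Qed.

Lemma expiE (R : realType) (t : R) : expi t = cos t +i* sin t. Proof. by []. Qed.

Lemma open_pos (R : realType) (U : topologicalType) (V : set U) (h : U -> R) :
  open V -> (forall x, V x -> {for x, continuous h}) -> open (V `&` [set x | 0 < h x]).
Proof.
move=> oV hc; rewrite openE => x [Vx /= hx].
apply: filterI; first exact: open_nbhs_nbhs.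
have h0 : nbhs (h x) [set y : R | 0 < y].
  by apply: open_nbhs_nbhs; split => //; exact: open_gt.
exact: (hc x Vx _ h0).
Qed.

Lemma local_param_sub (R : realType) n N (L : set 'rV[R]_N) (V V' : set 'rV[R]_n)
    (phi : 'rV[R]_n -> 'rV[R]_N) : open V' -> V' `<=` V ->
  local_param L V phi -> local_param L V' phi.
Proof.
move=> oV' sV [oV sm im inj hom]; split => //.
- by move=> k; exact: Ck_sub (sm k).
- by move=> u /sV; exact: im.
- by move=> u w; rewrite !inE => /sV Vu /sV Vw; apply: inj; rewrite inE.
- by move=> W oW /subset_trans/(_ sV); exact: hom.
Qed.

Lemma is_diff_ex (R : realType) (U W : normedModType R) (p : U) (f g df : U -> W) :
  f =1 g -> is_diff p g df -> differentiable f p.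
Proof. by move=> /funext -> dg; exact: (@ex_diff _ _ _ _ _ _ _ dg). Qed.

(** * The Lagrangian angle and its harmonicity *)

Section LagrangianAngle.
Variable R : realType.
Variables (a b c : R) (V : set 'rV[R]_3) (phi : 'rV[R]_3 -> 'rV[R]_(3 + 3)).
Hypothesis lp : local_param (smooth_part (fibre a b c)) V phi.

Let K u := chg (phi u) (frame phi u).
(** The signed real factor by which [Omega0] on the coordinate frame exceeds e^(-i Im z_3): on the
    explicit frame this factor is - [gdet]. Its absolute value is the volume density. *)
Definition angle_det u : R := - (\det (K u) * gdet (phi u)).

Lemma angle_det_neq0 u : V u -> angle_det u != 0.
Proof.
move=> Vu; have nz := param_nz lp Vu.
have := chg_unit nz (frame_tangent lp Vu) (frame_row_free lp Vu).
rewrite unitmxE unitfE oppr_eq0 => dk.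
by rewrite mulf_neq0 // gt_eqF // gdet_gt0.
Qed.

Lemma det_metric u : V u -> \det (metric phi u) = angle_det u ^+ 2.
Proof.
move=> Vu; have nz := param_nz lp Vu.
rewrite metricE (metric_chg nz (frame_tangent lp Vu)).
by rewrite 2!det_mulmx det_tr det_gram /angle_det /K; ring.
Qed.

Lemma Omega0_param u : V u ->
  Omega0 (fun i => partial i phi u) = expi (- yc o2 (phi u)) * (angle_det u)%:C.
Proof.
move=> Vu; have nz := param_nz lp Vu.
pose T := \matrix_(j, k) zcoord (row j (tframe (phi u))) k.
have rE j k : row j (tframe (phi u)) 0 k = tframe (phi u) j k by rewrite mxE.
have e : \matrix_(j, k) zcoord (partial j phi u) k = map_mx (real_complex R) (K u) *m T.
  apply/matrixP => i k; rewrite !mxE.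
  have -> : partial i phi u = row i (K u *m tframe (phi u)).
    by rewrite -(chgE nz (frame_tangent lp Vu)) rowK.
  rewrite /zcoord; apply/eqP; rewrite eq_complex; apply/andP; split; apply/eqP.
    rewrite raddf_sum /= mxE [LHS]mxE; apply: eq_bigr => j _.
    by rewrite [X in complex.Re (X * _)]mxE [T _ _]mxE /zcoord !rE /= mul0r subr0.
  rewrite raddf_sum /= mxE [LHS]mxE; apply: eq_bigr => j _.
  by rewrite [X in complex.Im (X * _)]mxE [T _ _]mxE /zcoord !rE /= mul0r addr0.
rewrite /Omega0 e det_mulmx det_map_mx.
have -> : \det T = expi (- yc o2 (phi u)) * (- gdet (phi u))%:C.
  rewrite det_mx33 !mxE !row_tframe /zcoord.
  rewrite -!/(xc _ _) -!/(yc _ _) /tv1 /tv2 /tv3 !(xcC3, ycC3) /=.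
  rewrite expiE cosN sinN /gdet /nsq1 /nsq2 /re12 /im12.
  set C := cos _; set S := sin _.
  move: (xc o0 _) (xc o1 _) (yc o0 _) (yc o1 _) => x1 x2 y1 y2.
  by apply/eqP; rewrite eq_complex /=; apply/andP; split; apply/eqP; ring.
by rewrite mulrCA -rmorphM /angle_det mulrN.
Qed.

Lemma sqrt_det_metric u : V u -> Num.sqrt (\det (metric phi u)) = `|angle_det u|.
Proof. by move=> Vu; rewrite det_metric // sqrtr_sqr. Qed.

(** Multiplied by e^(i Im z_3), the defining equation has a real right factor and a real value. The
    angle is thus - Im z_3 modulo pi only, the parity depending on the orientation of the frame. *)
Lemma sin_angle theta u : lagrangian_angle V phi theta -> V u ->
  sin (theta u + yc o2 (phi u)) = 0.
Proof.
move=> [_ H] Vu; have := H u Vu; rewrite Omega0_param // sqrt_det_metric //.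
move/(congr1 (fun z => expi (yc o2 (phi u)) * z)); rewrite !mulrA -!expiD addrN addrC.
move/(congr1 (@complex.Im R)); rewrite /expi cos0 sin0 /= mulr0 mul0r addr0 mulr0 add0r.
move/esym/eqP; rewrite mulf_eq0 normr_eq0 (negbTE (angle_det_neq0 Vu)) orbF.
by rewrite addrC => /eqP.
Qed.

Definition ye3 : 'rV[R]_(3 + 3) := C3 0 0 (0 +i* 1).

Lemma dotv_ye3 p : dotv p ye3 = yc o2 p.
Proof. by rewrite dotvE /ye3 !(xcC3, ycC3) /=; ring. Qed.

Lemma dotv_ye3N p : dotv p (- ye3) = - yc o2 p.
Proof. by rewrite -scaleN1r dotv_sym dotvZl mulN1r dotv_sym dotv_ye3. Qed.

(** Differentiating sin (theta + Im z_3) = 0, where the cosine is not zero, avoids choosing the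
    multiple of pi. *)
Lemma partial_angle theta k u : lagrangian_angle V phi theta -> V u ->
  partial k theta u = partial k (fun q => dotv (phi q) (- ye3)) u.
Proof.
move=> la Vu; have [sth _] := la.
have dth : differentiable theta u := smooth_diff sth Vu.
have dphi := param_diff lp Vu.
have dy : is_diff u (fun q => yc o2 (phi q)) (fun v => yc o2 ('d phi u v)).
  exact: (is_diff_coordf (rshift 3 o2) (differentiableP dphi)).
have ds := is_diff_addf (differentiableP dth) dy.
have dsin := @is_diff_compf _ _ _ (fun q => theta q + yc o2 (phi q)) _ _ _
  (is_derive_sin (theta u + yc o2 (phi u))) ds.
have e0 : 'D_(delta_mx 0 k) (fun q => sin (theta q + yc o2 (phi q))) u = 0.
  rewrite (@near_eq_derive _ _ _ _ (cst (0 : R))) ?derive_cst //.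
  by apply: (open_near_eq (lp_open lp) Vu) => w Vw; exact: sin_angle la Vw.
move: e0; rewrite deriveE; last exact: (@ex_diff _ _ _ _ _ _ _ dsin).
rewrite (@diff_val _ _ _ _ _ _ _ dsin) /= => /eqP; rewrite mulf_eq0.
have c0 : cos (theta u + yc o2 (phi u)) != 0.
  apply/eqP => c0; have := cos2Dsin2 (theta u + yc o2 (phi u)).
  by rewrite c0 (sin_angle la Vu) expr0n /= addr0 => /eqP; rewrite eq_sym oner_eq0.
rewrite (negbTE c0) /= addr_eq0 => /eqP e1.
rewrite partial_linear // /partial [in LHS]deriveE // e1 deriveE //.
by rewrite dotv_ye3N.
Qed.

(** The pairing of [e3] with [nv3] is c e^(-Re z_3) = 0, while the direction [ye3] of Im z_3 is
    orthogonal to [nv1] and [nv2]. As [igram] does not couple the third index with the first two,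
    the normal parts of the two vectors are orthogonal. *)
Lemma angle_harmonic theta u : c = 0 -> lagrangian_angle V phi theta -> V u ->
  laplacian phi theta u = 0.
Proof.
move=> c0 la Vu; rewrite (eq_laplacian _ (lp_open lp) Vu (fun k w => @partial_angle theta k w la)).
rewrite (laplacian_linear (lp_open lp) (lp_smooth lp)) // (soliton_equation lp) //.
rewrite (normal_part_nframe lp) // dotv_ye3N.
have [Lu _] := param_mem lp Vu.
have n3 : xc o2 (nv3 (phi u)) = 0.
  have := congr1 (fun q : 'rV[R]_3 => q 0 o2) Lu; rewrite muE !vec3E c0 => /eqP.
  rewrite mulf_eq0 gt_eqF ?expR_gt0 //= => /eqP e.
  by rewrite /nv3 !xcC3 /=.
have vN (v : 'rV[R]_(3 + 3)) i : (v *m (nframe (phi u))^T) 0 i = dotv v (row i (nframe (phi u))).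
  by rewrite mxE /dotv; apply: eq_bigr => k _; rewrite !mxE.
rewrite -dotv_ye3 dotv_mx -!mulmxA.
have -> : nframe (phi u) *m ye3^T = (ye3 *m (nframe (phi u))^T)^T by rewrite trmx_mul trmxK.
have key (E Y : 'rV[R]_3) : E 0 o2 = 0 -> Y 0 o0 = 0 -> Y 0 o1 = 0 ->
    (E *m igram (phi u) *m Y^T) 0 0 = 0.
  move=> E2 Y0 Y1; rewrite mxE sum_ord3 ![Y^T _ _]mxE Y0 Y1 !mulr0 !add0r.
  by rewrite mxE sum_ord3 E2 /igram !mxE /= !(mulr0, mul0r, add0r).
rewrite !mulmxA key ?oppr0 // vN row_nframe dotvE ?xc_e3 ?n3.
- by ring.
- by rewrite /ye3 /nv1 !(xcC3, ycC3) /=; ring.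
- by rewrite /ye3 /nv2 !(xcC3, ycC3) /=; ring.
Qed.

(** Since [gdet] > 0, the sign of [angle_det] can be read from this determinant, whose continuity is
    accessible. *)
Lemma angle_det_sign u : V u ->
  \det (frame phi u *m (tframe (phi u))^T) = - (angle_det u * gdet (phi u)).
Proof.
move=> Vu; have nz := param_nz lp Vu.
have e : frame phi u *m (tframe (phi u))^T = K u *m gram (phi u).
  have [<- _ _] := frame_gram (phi u).
  by rewrite {1}(chgE nz (frame_tangent lp Vu)) mulmxA.
by rewrite e det_mulmx det_gram /angle_det /K; ring.
Qed.

Lemma tangent_det_continuous u : V u ->
  {for u, continuous (fun w => \det (frame phi w *m (tframe (phi w))^T))}.
Proof.
move=> Vu.
suff : differentiable (fun w => \det (frame phi w *m (tframe (phi w))^T)) u.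
  exact: differentiable_continuous.
have dJ q : differentiable (@Jv R) q.
  apply: differentiable_rV; apply: ord6P; apply: ord3P; rewrite /Jv.
  - by apply: (is_diff_ex _ (is_diff_oppf (is_diff_yc q o0))) => r; rewrite -/(xc _ _) xcC3.
  - by apply: (is_diff_ex _ (is_diff_oppf (is_diff_yc q o1))) => r; rewrite -/(xc _ _) xcC3.
  - by apply: (is_diff_ex _ (is_diff_oppf (is_diff_yc q o2))) => r; rewrite -/(xc _ _) xcC3.
  - by apply: (is_diff_ex _ (is_diff_xc q o0)) => r; rewrite -/(yc _ _) ycC3.
  - by apply: (is_diff_ex _ (is_diff_xc q o1)) => r; rewrite -/(yc _ _) ycC3.
  - by apply: (is_diff_ex _ (is_diff_xc q o2)) => r; rewrite -/(yc _ _) ycC3.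
(* Derivatives are available for the normals, so <x, tv> is rewritten as <i x, nv>. *)
pose G j (nv : 'rV[R]_(3 + 3) -> 'rV[R]_(3 + 3)) w := dotv (Jv (partial j phi w)) (nv (phi w)).
have dG j nv : differentiable nv (phi u) -> differentiable (G j nv) u.
  move=> dn; have d1 : differentiable (@Jv R \o partial j phi) u.
    by apply: differentiable_comp => //; exact: (partial_diff lp).
  have d2 : differentiable (nv \o phi) u by apply: differentiable_comp => //; exact: (param_diff lp).
  have dd := is_diff_dotv (differentiableP d1) (differentiableP d2).
  exact: (@ex_diff _ _ _ _ _ _ _ dd).
have GE j w : [/\ G j (@nv1 R) w = dotv (partial j phi w) (tv1 (phi w)),
    G j (@nv2 R) w = dotv (partial j phi w) (tv2 (phi w)) &
    G j (@nv3 R) w = dotv (partial j phi w) (tv3 (phi w))].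
  by split; rewrite /G !dotvE /Jv /tv1 /tv2 /tv3 /nv1 /nv2 /nv3 !(xcC3, ycC3) /=; ring.
pose n1 := @nv1 R; pose n2 := @nv2 R; pose n3 := @nv3 R.
have mE w : frame phi w *m (tframe (phi w))^T =
    \matrix_(j < 3, a < 3) [:: G j n1 w; G j n2 w; G j n3 w]`_a.
  apply/matrixP => j; have [a1 a2 a3] := GE j w.
  by apply: ord3P; rewrite mulmx_trE row_tframe rowK mxE; exact: esym.
have -> : (fun w => \det (frame phi w *m (tframe (phi w))^T)) =
    G o0 n1 * (G o1 n2 * G o2 n3 - G o1 n3 * G o2 n2)
    - G o0 n2 * (G o1 n1 * G o2 n3 - G o1 n3 * G o2 n1)
    + G o0 n3 * (G o1 n1 * G o2 n2 - G o1 n2 * G o2 n1).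
  by apply/funext => w; rewrite mE det_mx33 !mxE.
have d1 j : differentiable (G j n1) u.
  by apply: dG; have dn := is_diff_nv1 (phi u); exact: (@ex_diff _ _ _ _ _ _ _ dn).
have d2 j : differentiable (G j n2) u.
  by apply: dG; have dn := is_diff_nv2 (phi u); exact: (@ex_diff _ _ _ _ _ _ _ dn).
have d3 j : differentiable (G j n3) u.
  by apply: dG; have dn := is_diff_nv3 (phi u); exact: (@ex_diff _ _ _ _ _ _ _ dn).
by do ?[apply: differentiableD|apply: differentiableN|apply: differentiableM].
Qed.

Lemma lagrangian_angle_ex u : V u -> exists V' theta,
  [/\ local_param (smooth_part (fibre a b c)) V' phi, V' u & lagrangian_angle V' phi theta].
Proof.
move=> Vu.
pose h w := \det (frame phi w *m (tframe (phi w))^T).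
have hE w : V w -> h w = - (angle_det w * gdet (phi w)) by exact: angle_det_sign.
have g0 w : V w -> 0 < gdet (phi w) by move=> Vw; apply/gdet_gt0/(param_nz lp Vw).
have hc w : V w -> {for w, continuous h} by exact: tangent_det_continuous.
have sy (k : R) : smooth_on V (fun w => k - yc o2 (phi w)).
  move=> m; apply: (@CkD _ _ _ _ _ (cst k)); [exact: (lp_open lp)|exact: Ck_cst|].
  rewrite (_ : (fun w => - yc o2 (phi w)) = cst (-1) * (fun w => yc o2 (phi w))); last first.
    by apply/funext => w; rewrite !fctE mulN1r.
  apply: CkM; [exact: (lp_open lp)|exact: Ck_cst|].
  by apply: Ck_coord; [exact: (lp_open lp)|exact: (lp_smooth lp)].
(* On the open set where the determinant is positive, [angle_det] is negative and the shift by pi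
   absorbs the sign; where it is negative no shift is required. *)
have main (s k : R) : (s = 1 /\ k = pi) \/ (s = -1 /\ k = 0) -> 0 < s * h u -> exists V' theta,
  [/\ local_param (smooth_part (fibre a b c)) V' phi, V' u & lagrangian_angle V' phi theta].
  move=> sk su; exists (V `&` [set w | 0 < s * h w]), (fun w => k - yc o2 (phi w)).
  have sub : V `&` [set w | 0 < s * h w] `<=` V by move=> w [].
  split => //.
    apply: local_param_sub lp => //; apply: open_pos (lp_open lp) _ => w Vw.
    by apply: (@continuousM _ _ (cst s) h); [exact: cst_continuous|exact: hc].
  split; first by move=> m; exact: Ck_sub sub (sy k m).
  move=> w [Vw /= sw]; rewrite Omega0_param // sqrt_det_metric //.
  have : 0 < - (s * angle_det w).
    move: sw; rewrite hE // mulrN mulrA -mulNr pmulr_lgt0 //; exact: g0.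
  case: sk => -[-> ->].
    rewrite mul1r oppr_gt0 => /ltr0_norm ->.
    by rewrite /expi cosN sinN cosB sinB cospi sinpi; apply/eqP; rewrite eq_complex /=;
      apply/andP; split; apply/eqP; ring.
  by rewrite mulN1r opprK sub0r => /gtr0_norm ->.
have h0 : h u != 0 by rewrite hE // oppr_eq0 mulf_neq0 ?angle_det_neq0 // gt_eqF // g0.
case: (ltgtP (h u) 0) h0 => // hu _.
- by apply: (main (-1) 0); [right|rewrite mulN1r oppr_gt0].
- by apply: (main 1 pi); [left|rewrite mul1r].
Qed.

End LagrangianAngle.

(** * Criteria for charts and a one-variable inverse function theorem *)

Section Charts.
Variable R : realType.

Lemma linear_rV_continuous n (W : normedModType R) (f : {linear 'rV[R]_n -> W}) :
  continuous f.
Proof.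
move=> x; apply: differentiable_continuous.
have -> : (f : 'rV[R]_n -> W) = \sum_(i < n) (fun y : 'rV[R]_n => y 0 i *: f (delta_mx 0 i)).
  apply/funext => y; rewrite fct_sumE {1}(row_sum_delta y) linear_sum /=.
  by apply: eq_bigr => i _; rewrite linearZ.
by apply: differentiable_sum => i; apply: differentiableZl; exact: differentiable_coord.
Qed.

Lemma open_preimage_on (U W : topologicalType) (O : set U) (B : set W) (g : U -> W) :
  open O -> open B -> (forall x, O x -> {for x, continuous g}) -> open (O `&` g @^-1` B).
Proof.
move=> oO oB gc; rewrite openE => x [Ox Bx].
apply: filterI; first exact: open_nbhs_nbhs.
by apply: (gc x Ox B); exact: open_nbhs_nbhs.
Qed.

(** A differentiable left inverse g on an open O yields every clause: its differential inverts that
    of phi, phi is injective, and phi @[W is L cut by the open set O]&[g @^-1] W. *)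
Lemma local_param_left_inverse n N (L : set 'rV[R]_N) (V : set 'rV[R]_n)
    (phi : 'rV[R]_n -> 'rV[R]_N) (O : set 'rV[R]_N) (g : 'rV[R]_N -> 'rV[R]_n) :
  open V -> smooth_on V phi -> open O -> (forall p, O p -> differentiable g p) ->
  (forall u, V u -> [/\ L (phi u), O (phi u) & g (phi u) = u]) ->
  (forall p, L p -> O p -> V (g p) /\ phi (g p) = p) ->
  local_param L V phi.
Proof.
move=> oV sphi oO dg gphi phig; split => //.
- move=> u Vu; have [_ Ou _] := gphi u Vu.
  have dphi : differentiable phi u := smooth_diff sphi Vu.
  have dgu : differentiable g (phi u) by exact: dg.
  have e x : 'd g (phi u) ('d phi u x) = x.
    rewrite -[LHS]/(('d g (phi u) \o 'd phi u) x) -diff_comp //.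
    rewrite -deriveE; last exact: differentiable_comp.
    rewrite (@near_eq_derive _ _ _ _ id) ?derive_id //.
    by apply: (open_near_eq oV Vu) => y /gphi[].
  by move=> x y exy; rewrite -(e x) -(e y) exy.
- move=> u w; rewrite !inE => /gphi[_ _ eu] /gphi[_ _ ew] e.
  by rewrite -eu -ew e.
- move=> W oW WV; exists (O `&` g @^-1` W).
    apply: open_preimage_on => // p Op; apply: differentiable_continuous; exact: dg.
  apply/seteqP; split=> p.
    by move=> [u Wu <-]; have [Lu Ou eu] := gphi u (WV _ Wu); split=> //; split=> //=; rewrite eu.
  by move=> [Lp [Op Wp]]; exists (g p) => //; have [] := phig p Lp Op.
Qed.

Lemma local_param_transport n N (L L' : set 'rV[R]_N) (V : set 'rV[R]_n)
    (phi : 'rV[R]_n -> 'rV[R]_N) (f g : {linear 'rV[R]_N -> 'rV[R]_N}) :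
  cancel f g -> cancel g f -> (forall p, L p -> L' (f p)) -> (forall p, L' p -> L (g p)) ->
  local_param L V phi -> local_param L' V (f \o phi).
Proof.
move=> fK gK LL' L'L lp; have oV := lp_open lp.
have cf : continuous f := @linear_rV_continuous _ _ f.
split => //.
- by move=> k; apply: Ck_linear => //; exact: (lp_smooth lp).
- move=> u Vu; have dphi : differentiable phi u := smooth_diff (lp_smooth lp) Vu.
  have df : differentiable f (phi u) by exact: linear_differentiable.
  have dfp : differentiable (f \o phi) u := differentiable_comp dphi df.
  have de x : 'd (f \o phi) u x = f ('d phi u x).
    apply: (etrans (esym (deriveE x dfp))).
    apply: (etrans (derive_linear x cf dphi)).
    exact: (congr1 f (deriveE x dphi)).
  move=> x y exy; have := etrans (esym (de x)) (etrans exy (de y)).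
  by move=> /(can_inj fK) e; exact: (lp_immersion lp Vu e).
- by move=> u w Vu Vw /= /(can_inj fK); exact: (lp_inj lp).
- move=> W oW WV; have [U oU e] := lp_homeo lp oW WV.
  exists (g @^-1` U).
    by apply: open_comp => // p _; exact: (@linear_rV_continuous _ _ g).
  apply/seteqP; split=> p.
    move=> [u Wu <-]; have : (phi @` W) (phi u) by exists u.
    by rewrite e => -[Lu Uu]; split; [exact: LL'|rewrite /= fK].
  move=> [Lp Up]; have : (L `&` U) (g p) by split=> //; exact: L'L.
  by rewrite -e => -[u Wu eu]; exists u => //=; rewrite eu gK.
Qed.

(** Where f' > 0 the function is strictly increasing, so the intermediate value theorem inverts it
    on an interval; smoothness of the inverse is then bootstrapped by [smooth_inverse]. *)
Lemma smooth_local_inverse (f f' : R -> R) (q0 : R) (J0 : set R) :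
  (forall x : R, is_derive x 1 f (f' x)) -> smooth_on setT f' -> 0 < f' q0 ->
  nbhs q0 J0 ->
  exists I J h, [/\ open I, open J, J q0, J `<=` J0
    & [/\ smooth_on I h, (forall y, I y -> J (h y) /\ f (h y) = y)
      & (forall q, J q -> I (f q) /\ h (f q) = q)]].
Proof.
move=> df sf' f'0 nJ0.
have cf : continuous f.
  by move=> x; apply: differentiable_continuous; apply/derivable1_diffP; case: (df x).
have cf' : continuous f' by move=> x; exact: (sf' 0).
have npos : nbhs q0 [set x | 0 < f' x].
  by apply: (cf' q0 [set y | 0 < y]); apply: open_nbhs_nbhs; split => //; exact: open_gt.
have /nbhs_ballP[e /= e0 eP] : nbhs q0 (J0 `&` [set x | 0 < f' x]) by exact: filterI.
(* Half the radius keeps the closed interval inside the ball. *)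
pose q1 := q0 - e / 2; pose q2 := q0 + e / 2.
have e20 : 0 < e / 2 by rewrite divr_gt0.
have inE x : q1 <= x <= q2 -> J0 x /\ 0 < f' x.
  move=> /andP[x1 x2]; apply: eP; rewrite -ball_normE /= ltr_distlC.
  by rewrite /q1 /q2 in x1 x2; apply/andP; split; lra.
have incr x y : q1 <= x -> x < y -> y <= q2 -> f x < f y.
  move=> x1 xy y2.
  have cw : {within `[x, y], continuous f} by exact: continuous_subspaceT.
  have [z] := MVT xy (fun z _ => df z) cw.
  rewrite in_itv /= => /andP[xz zy] e1; rewrite -subr_gt0 e1 mulr_gt0 ?subr_gt0 //.
  by have [] := inE z; [apply/andP; split; lra|].
have finj x y : q1 <= x <= q2 -> q1 <= y <= q2 -> f x = f y -> x = y.
  move=> /andP[x1 x2] /andP[y1 y2] fxy.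
  by case: (ltgtP x y) => // xy; [have := incr _ _ x1 xy y2|have := incr _ _ y1 xy x2];
    rewrite fxy ltxx.
have q12 : q1 < q2 by rewrite /q1 /q2; lra.
pose J : set R := [set x | q1 < x < q2].
pose I : set R := [set y | f q1 < y < f q2].
have oitv (x y : R) : open [set z | x < z < y].
  rewrite (_ : [set z | _] = `]x, y[%classic); first exact: interval_open.
  by apply/seteqP; split=> z /=; rewrite in_itv.
(* On I a preimage in J exists; elsewhere the value defaults to [q0]. *)
pose h y := xget q0 [set x | J x /\ f x = y].
have hP y : I y -> J (h y) /\ f (h y) = y.
  move=> /andP[y1 y2]; apply: (@xgetPex _ q0 [set x | J x /\ f x = y]).
  have cw : {within `[q1, q2], continuous f} by exact: continuous_subspaceT.
  have f12 := incr _ _ (lexx q1) q12 (lexx q2).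
  have [|x] := IVT (ltW q12) cw (v := y).
    by rewrite minEle maxEle (ltW f12) (ltW y1) (ltW y2).
  rewrite in_itv /= => /andP[x1 x2] fx; exists x; split => //; apply/andP; split.
    by rewrite lt_neqAle x1 andbT; apply/eqP => ex; rewrite ex fx ltxx in y1.
  by rewrite lt_neqAle x2 andbT; apply/eqP => ex; rewrite -ex fx ltxx in y2.
have JW x : J x -> q1 <= x <= q2 by move=> /andP[x1 x2]; rewrite !ltW.
have JI x : J x -> I (f x).
  by move=> /andP[x1 x2]; apply/andP; split; apply: incr => //; exact: ltW.
have hK x : J x -> h (f x) = x.
  move=> Jx; have [Jh fh] := hP _ (JI x Jx).
  by apply: finj => //; exact: JW.
have oI : open I by exact: oitv.
have oJ : open J by exact: oitv.
exists I, J, h; split => //.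
- by rewrite /J /q1 /q2 /=; apply/andP; split; lra.
- by move=> x /JW /inE[].
split => //; last by move=> q Jq; split; [exact: JI|exact: hK].
apply: (@smooth_inverse _ I J f f' h) => //.
- by move=> y /hP[].
- by move=> k; apply: Ck_sub (sf' k).
- by move=> x /JW /inE[_ fx]; rewrite gt_eqF.
move=> y Iy; have [Jh fh] := hP y Iy.
rewrite -{1}fh; apply: is_derive_inverse (df _) _.
- by near=> z; apply: hK; near: z; exact: open_nbhs_nbhs.
- by near=> z; exact: cf.
- by have [_ fx] := inE _ (JW _ Jh); rewrite gt_eqF.
Unshelve. all: by end_near. Qed.

End Charts.

(** * Smoothness by following the syntax of a formula *)

Section SmoothRules.
Variables (R : realType) (U : normedModType R) (V : set U).
Hypothesis oV : open V.
Implicit Types f g : U -> R.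

Lemma smooth_addf f g : smooth_on V f -> smooth_on V g -> smooth_on V (fun x => f x + g x).
Proof. by move=> sf sg k; exact: CkD. Qed.

Lemma smooth_mulf f g : smooth_on V f -> smooth_on V g -> smooth_on V (fun x => f x * g x).
Proof. by move=> sf sg k; exact: CkM. Qed.

Lemma smooth_cstf (c : R) : smooth_on V (fun=> c).
Proof. by move=> k; exact: Ck_cst. Qed.

Lemma smooth_oppf f : smooth_on V f -> smooth_on V (fun x => - f x).
Proof.
move=> sf; rewrite (_ : (fun x => - f x) = (fun x => -1 * f x)); last first.
  by apply/funext => x; rewrite mulN1r.
exact: smooth_mulf (smooth_cstf _) sf.
Qed.

Lemma smooth_compf (I : set R) (h : R -> R) f : smooth_on I h -> smooth_on V f ->
  (forall x, V x -> I (f x)) -> smooth_on V (fun x => h (f x)).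
Proof. by move=> sh sf fI k; exact: (Ck_comp oV (sh k) (sf k) fI). Qed.

End SmoothRules.

Lemma smooth_coord (R : realType) n (V : set 'rV[R]_n) j :
  open V -> smooth_on V (fun u : 'rV[R]_n => u 0 j).
Proof.
move=> oV k; apply: (@Ck_coord _ _ _ _ _ id) => //.
case: k => [|k]; first by move=> x _; exact: cvg_id.
split=> [x _|v]; first by have d := is_diff_id x; exact: (@ex_diff _ _ _ _ _ _ _ d).
rewrite (_ : 'D_v id = cst v); first exact: Ck_cst.
by apply/funext => x; exact: derive_id.
Qed.

(** * Explicit charts of the smooth part where Re z_2 > 0 *)

Section FibreChart.
Variable R : realType.

Lemma fibreE (a b c : R) p : fibre a b c p <->
  [/\ xc o2 p = a + nsq1 p / 2, xc o2 p = b + nsq2 p / 2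
    & expR (xc o2 p) * (cos (yc o2 p) * im12 p + sin (yc o2 p) * re12 p) = c].
Proof.
rewrite /fibre /= muE; split.
  move=> e; have e0 := congr1 (fun q : 'rV[R]_3 => q 0 o0) e.
  have e1 := congr1 (fun q : 'rV[R]_3 => q 0 o1) e.
  have e2 := congr1 (fun q : 'rV[R]_3 => q 0 o2) e.
  rewrite /= !vec3E in e0 e1 e2; split => //.
    by rewrite -e0; field.
  by rewrite -e1; field.
move=> [e0 e1 ->]; congr vec3; first by rewrite e0; field.
by rewrite e1; field.
Qed.

Variables a b c : R.

(* On the fibre |z_1 z_2 e^(z_3)|^2 = profile |z_2|^2. *)
Definition profile (q : R) := q * (q + 2 * (b - a)) * expR (q + 2 * b).
Definition dprofile (q : R) :=
  (q * (q + 2 * (b - a)) + 2 * (q + (b - a))) * expR (q + 2 * b).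

Lemma is_derive_profile (q : R) : is_derive q 1 profile (dprofile q).
Proof.
have d1 : is_diff q (fun q : R => q) id by exact: is_diff_id.
have d2 := is_diff_addf d1 (is_diff_cstf q (2 * (b - a))).
have d3 := is_diff_addf d1 (is_diff_cstf q (2 * b)).
have d4 := @is_diff_compf _ _ _ (fun q : R => q + 2 * b) _ _ _ (is_derive_expR (q + 2 * b)) d3.
have d5 := is_diff_mulf (is_diff_mulf d1 d2) d4.
split; first by apply/derivable1_diffP; exact: (@ex_diff _ _ _ _ _ _ _ d5).
rewrite deriveE; last exact: (@ex_diff _ _ _ _ _ _ _ d5).
by rewrite (@diff_val _ _ _ _ _ _ _ d5) /= /dprofile; ring.
Qed.

Lemma smooth_dprofile : smooth_on setT dprofile.
Proof.
have oT : open (setT : set R) by exact: openT.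
have s1 : smooth_on setT (fun q : R => q).
  case=> [|k]; first by move=> x _; exact: cvg_id.
  split=> [x _|v]; first by have d := is_diff_id x; exact: (@ex_diff _ _ _ _ _ _ _ d).
  rewrite (_ : 'D_v _ = cst v); first exact: Ck_cst.
  by apply/funext => x; exact: derive_id.
have sc (k : R) := @smooth_cstf R R setT k.
rewrite /dprofile; apply: smooth_mulf => //.
  by do ?[apply: smooth_addf|apply: smooth_mulf].
apply: (smooth_compf oT (@smooth_expR R)) => //.
by apply: smooth_addf.
Qed.

Section Chart.
Variables (I J : set R) (h : R -> R).
Hypotheses (oI : open I) (oJ : open J) (J0 : forall q, J q -> 0 < q)
  (sh : smooth_on I h) (hP : forall y, I y -> J (h y) /\ profile (h y) = y)
  (hK : forall q, J q -> I (profile q) /\ h (profile q) = q).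

Definition chart_dom : set 'rV[R]_3 := [set u | I (u 0 o0 * u 0 o0 + c * c)].
(** In terms of the point, [chart_rho] is |z_2|, [chart_x] is Re z_3 and [chart_n] is Re z_2 /
    |z_2|. *)
Definition chart_rho (u : 'rV[R]_3) := Num.sqrt (h (u 0 o0 * u 0 o0 + c * c)).
Definition chart_x (u : 'rV[R]_3) := b + h (u 0 o0 * u 0 o0 + c * c) / 2.
Definition chart_n (u : 'rV[R]_3) := (Num.sqrt (1 + u 0 o1 * u 0 o1))^-1.
(** z_1 is recovered as (r + i c) e^(-z_3) / z_2. With z_2 = rho n (1 + i t) one has 1 / z_2 = (n /
    rho) (1 - i t), and [chart_E] collects the positive real factors. *)
Definition chart_E (u : 'rV[R]_3) := expR (- chart_x u) * (chart_n u * (chart_rho u)^-1).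

(* The coordinates (r, t, s) are r + i c = z_1 z_2 e^(z_3), t = Im z_2 / Re z_2, s = Im z_3. *)
Definition chart_phi (u : 'rV[R]_3) : 'rV[R]_(3 + 3) :=
  let C := cos (u 0 o2) in let S := sin (u 0 o2) in
  let al := u 0 o0 * C + c * S in let be := c * C - u 0 o0 * S in
  C3 ((chart_E u * (al + be * u 0 o1)) +i* (chart_E u * (be - al * u 0 o1)))
     ((chart_rho u * chart_n u) +i* (chart_rho u * chart_n u * u 0 o1))
     (chart_x u +i* u 0 o2).

Definition chart_inv (p : 'rV[R]_(3 + 3)) : 'rV[R]_3 :=
  vec3 (expR (xc o2 p) * (cos (yc o2 p) * re12 p - sin (yc o2 p) * im12 p))
       (yc o1 p / xc o1 p) (yc o2 p).

Definition chart_rng : set 'rV[R]_(3 + 3) := [set p | 0 < xc o1 p /\ J (nsq2 p)].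

Lemma open_chart_dom : open chart_dom.
Proof.
apply: open_comp => // u _; apply: differentiable_continuous.
have d0 := is_diff_coord u o0.
have d1 := is_diff_addf (is_diff_mulf d0 d0) (is_diff_cstf u (c * c)).
exact: (@ex_diff _ _ _ _ _ _ _ d1).
Qed.

Lemma smooth_chart : smooth_on chart_dom chart_phi.
Proof.
have oV := open_chart_dom.
have s j : smooth_on chart_dom (fun u : 'rV[R]_3 => u 0 j) by exact: smooth_coord.
have sc (k : R) := @smooth_cstf R _ chart_dom k.
have [ssin scos] := smooth_sin_cos R.
have sq : smooth_on chart_dom (fun u => h (u 0 o0 * u 0 o0 + c * c)).
  apply: (smooth_compf oV sh) => //.
  by apply: smooth_addf => //; exact: smooth_mulf.
have sr : smooth_on chart_dom chart_rho.
  by apply: (smooth_compf oV (@smooth_sqrt R)) => // u /hP[/J0].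
have sir : smooth_on chart_dom (fun u => (chart_rho u)^-1).
  apply: (smooth_compf oV (@smooth_inv R)) => // u /hP[/J0 h0 _] /=.
  by rewrite gt_eqF // sqrtr_gt0.
have tpos (u : 'rV[R]_3) : 0 < 1 + u 0 o1 * u 0 o1.
  by rewrite ltr_wpDr // -expr2 sqr_ge0.
have sn : smooth_on chart_dom chart_n.
  apply: (smooth_compf oV (@smooth_inv R)).
    apply: (smooth_compf oV (@smooth_sqrt R)); last by move=> u _; exact: tpos.
    by apply: smooth_addf => //; exact: smooth_mulf.
  by move=> u _ /=; rewrite gt_eqF // sqrtr_gt0.
have sx : smooth_on chart_dom chart_x.
  by apply: smooth_addf => //; exact: smooth_mulf.
have sE : smooth_on chart_dom chart_E.
  apply: smooth_mulf => //; last exact: smooth_mulf.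
  by apply: (smooth_compf oV (@smooth_expR R)) => //; exact: smooth_oppf.
have sC : smooth_on chart_dom (fun u : 'rV[R]_3 => cos (u 0 o2)).
  exact: (smooth_compf oV scos).
have sS : smooth_on chart_dom (fun u : 'rV[R]_3 => sin (u 0 o2)).
  exact: (smooth_compf oV ssin).
move=> k; apply: Ck_rV => //.
have ext (f g : 'rV[R]_3 -> R) : g =1 f -> smooth_on chart_dom f -> Ck k chart_dom g.
  by move=> /funext -> sf; exact: sf.
by apply: ord6P; apply: ord3P; rewrite /chart_phi; (eapply ext;
  [by move=> u; rewrite -/(xc _ _) -/(yc _ _) ?xcC3 ?ycC3 /=; reflexivity|]);
  repeat first [exact: sE | exact: sr | exact: sn | exact: sx | exact: s | exact: sc
   | exact: sC | exact: sS | exact: oV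
   | apply: smooth_addf | apply: smooth_oppf | apply: smooth_mulf].
Qed.

Lemma chart_phiK p : smooth_part (fibre a b c) p -> chart_rng p ->
  chart_dom (chart_inv p) /\ chart_phi (chart_inv p) = p.
Proof.
move=> [] /fibreE[e1 e2 e3] nz [x0 Jq].
  have q0 := J0 Jq.
  have XX : expR (xc o2 p) * expR (- xc o2 p) = 1 by rewrite expRxMexpNx_1.
  have cs := cosx2 (yc o2 p).
  pose r := expR (xc o2 p) * (cos (yc o2 p) * re12 p - sin (yc o2 p) * im12 p).
  (* With q = |z_2|^2 the fibre equations read |z_1|^2 = q + 2 (b - a) and 2 Re z_3 = q + 2 b. *)
  have rc : r * r + c * c = profile (nsq2 p).
    rewrite /profile (_ : nsq2 p + 2 * (b - a) = nsq1 p); last by lra.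
    rewrite (_ : nsq2 p + 2 * b = xc o2 p + xc o2 p); last by lra.
    rewrite expRD -e3 /r /nsq1 /nsq2 /re12 /im12; ring: cs.
  have [Ip hp] := hK Jq; rewrite -rc in Ip hp.
  have i0 : chart_inv p 0 o0 = r by rewrite /chart_inv vec3E.
  have i1 : chart_inv p 0 o1 = yc o1 p / xc o1 p by rewrite /chart_inv vec3E.
  have i2 : chart_inv p 0 o2 = yc o2 p by rewrite /chart_inv vec3E.
  split; first by rewrite /chart_dom /= i0.
  have x0' : xc o1 p != 0 by rewrite gt_eqF.
  have rho0 : 0 < Num.sqrt (nsq2 p) by rewrite sqrtr_gt0.
  have rho2 : Num.sqrt (nsq2 p) ^+ 2 = nsq2 p by rewrite sqr_sqrtr // ltW.
  have rhoE : chart_rho (chart_inv p) = Num.sqrt (nsq2 p) by rewrite /chart_rho i0 hp.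
  have nE : chart_n (chart_inv p) = xc o1 p / Num.sqrt (nsq2 p).
    rewrite /chart_n i1 (_ : 1 + _ = nsq2 p / (xc o1 p) ^+ 2); last first.
      by rewrite /nsq2; field.
    by rewrite sqrtrM ?ltW // sqrtrV ?sqr_ge0 // sqrtr_sqr gtr0_norm // invfM invrK mulrC.
  have xE : chart_x (chart_inv p) = xc o2 p by rewrite /chart_x i0 hp e2.
  have EE : chart_E (chart_inv p) = expR (- xc o2 p) * (xc o1 p / nsq2 p).
    by rewrite /chart_E xE nE rhoE -[X in _ * X]mulrA -invfM -expr2 rho2.
  have al : r * cos (yc o2 p) + c * sin (yc o2 p) = expR (xc o2 p) * re12 p.
    by rewrite -e3 /r; ring: cs.
  have be : c * cos (yc o2 p) - r * sin (yc o2 p) = expR (xc o2 p) * im12 p.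
    by rewrite -e3 /r; ring: cs.
  have X0 : expR (xc o2 p) != 0 by rewrite gt_eqF // expR_gt0.
  have XV : expR (- xc o2 p) = (expR (xc o2 p))^-1 by rewrite expRN.
  have q0' : nsq2 p != 0 by rewrite gt_eqF.
  apply: row6P; apply: ord3P; rewrite /chart_phi !(xcC3, ycC3) /= ?i0 ?i1 ?i2 ?rhoE ?nE ?xE ?EE ?al ?be //.
  + rewrite XV; move: q0'; rewrite /nsq2 /re12 /im12 => q0'; field.
    by rewrite X0 x0' q0'.
  + by field; rewrite gt_eqF.
  + rewrite XV; move: q0'; rewrite /nsq2 /re12 /im12 => q0'; field.
    by rewrite X0 x0' q0'.
  + by field; rewrite x0' gt_eqF.
Qed.

Lemma chart_param : local_param (smooth_part (fibre a b c)) chart_dom chart_phi.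
Proof.
have tpos (u : 'rV[R]_3) : 0 < 1 + u 0 o1 ^+ 2 by rewrite ltr_wpDr // sqr_ge0.
apply: (@local_param_left_inverse _ _ _ _ _ _ chart_rng chart_inv).
- exact: open_chart_dom.
- exact: smooth_chart.
- rewrite (_ : chart_rng = [set p | 0 < xc o1 p] `&` (nsq2 (R := R)) @^-1` J) //.
  apply: open_preimage_on => //.
    apply: (@open_comp _ _ (xc o1) [set y : R | 0 < y]); last exact: open_gt.
    by move=> p _; exact: coord_continuous.
  move=> p _; apply: differentiable_continuous.
  have dx := is_diff_xc p o1; have dy := is_diff_yc p o1.
  have dd := is_diff_addf (is_diff_mulf dx dx) (is_diff_mulf dy dy).
  exact: (@ex_diff _ _ _ _ _ _ _ dd).
- move=> p [p1 _]; apply: differentiable_rV.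
  have d j := is_diff_xc p j; have e j := is_diff_yc p j.
  apply: ord3P.
  + have dre := is_diff_addf (is_diff_mulf (d o0) (d o1)) (is_diff_oppf (is_diff_mulf (e o0) (e o1))).
    have dim := is_diff_addf (is_diff_mulf (d o0) (e o1)) (is_diff_mulf (e o0) (d o1)).
    have dC := @is_diff_compf _ _ _ _ _ _ _ (is_derive_cos (yc o2 p)) (e o2).
    have dS := @is_diff_compf _ _ _ _ _ _ _ (is_derive_sin (yc o2 p)) (e o2).
    have dE := @is_diff_compf _ _ _ _ _ _ _ (is_derive_expR (xc o2 p)) (d o2).
    have dd := is_diff_mulf dE (is_diff_addf (is_diff_mulf dC dre) (is_diff_oppf (is_diff_mulf dS dim))).
    rewrite (_ : (fun q => _) = (fun q => chart_inv q 0 o0)) //.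
    by apply: (is_diff_ex _ dd) => q; rewrite /chart_inv vec3E.
  + have dV : differentiable (fun q => (xc o1 q)^-1) p.
      apply: differentiableV; last by rewrite gt_eqF.
      have d1 := d o1; exact: (@ex_diff _ _ _ _ _ _ _ d1).
    have dd := is_diff_mulf (e o1) (differentiableP dV).
    by apply: (is_diff_ex _ dd) => q; rewrite /chart_inv vec3E.
  + by apply: (is_diff_ex _ (e o2)) => q; rewrite /chart_inv vec3E.
- move=> u Iu; have [Jh Ph] := hP Iu; have q0 := J0 Jh.
  set r := u 0 o0; set t := u 0 o1; set s := u 0 o2.
  have rE : chart_rho u ^+ 2 = h (r * r + c * c) by rewrite sqr_sqrtr // ltW.
  have r0 : 0 < chart_rho u by rewrite sqrtr_gt0.
  have xE : chart_x u = b + h (r * r + c * c) / 2 by [].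
  have nE : chart_n u ^+ 2 * (1 + t ^+ 2) = 1.
    rewrite /chart_n exprVn -expr2 sqr_sqrtr ?ltW ?tpos // mulVf // gt_eqF //; exact: tpos.
  have n0 : 0 < chart_n u by rewrite invr_gt0 sqrtr_gt0 -expr2; exact: tpos.
  have XX : expR (chart_x u) * expR (- chart_x u) = 1 by rewrite expRxMexpNx_1.
  have X2 : expR (h (r * r + c * c) + 2 * b) = expR (chart_x u) ^+ 2.
    by rewrite expr2 -expRD xE; congr expR; field.
  rewrite -/r /profile X2 in Ph q0.
  have cs := cosx2 s.
  rewrite /fibre /smooth_part.
  have [px py] := (xcC3, ycC3).
  set p := chart_phi u.
  have hx2 : xc o1 p = chart_rho u * chart_n u by rewrite /p /chart_phi xcC3.
  have hy2 : yc o1 p = chart_rho u * chart_n u * t by rewrite /p /chart_phi ycC3.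
  have hx3 : xc o2 p = chart_x u by rewrite /p /chart_phi xcC3.
  have hy3 : yc o2 p = s by rewrite /p /chart_phi ycC3.
  pose al := r * cos s + c * sin s; pose be := c * cos s - r * sin s.
  have hx1 : xc o0 p = chart_E u * (al + be * t) by rewrite /p /chart_phi xcC3.
  have hy1 : yc o0 p = chart_E u * (be - al * t) by rewrite /p /chart_phi ycC3.
  have EE : chart_E u * chart_rho u * chart_n u * (1 + t ^+ 2) = expR (- chart_x u).
    rewrite -[RHS]mulr1 -[X in _ = _ * X]nE /chart_E; field; by rewrite gt_eqF.
  have re : re12 p = expR (- chart_x u) * al.
    by rewrite -EE /re12 hx1 hx2 hy1 hy2; ring.
  have im : im12 p = expR (- chart_x u) * be.
    by rewrite -EE /im12 hx1 hx2 hy1 hy2; ring.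
  have ns2 : nsq2 p = h (r * r + c * c).
    by rewrite -rE -[RHS]mulr1 -nE /nsq2 hx2 hy2; ring.
  have ab : al ^+ 2 + be ^+ 2 = r ^+ 2 + c ^+ 2 by rewrite /al /be; ring: cs.
  have ns12 : nsq1 p * nsq2 p = expR (- chart_x u) ^+ 2 * (r ^+ 2 + c ^+ 2).
    have -> : nsq1 p * nsq2 p = re12 p ^+ 2 + im12 p ^+ 2.
      by rewrite /nsq1 /nsq2 /re12 /im12; ring.
    by rewrite re im -ab; ring.
  (* Cancel |z_2|^2 > 0 between the product |z_1|^2 |z_2|^2 and the equation saying that h inverts
     [profile]. *)
  have ns1 : nsq1 p = h (r * r + c * c) + 2 * (b - a).
    have q0' : h (r * r + c * c) != 0 by rewrite gt_eqF.
    apply: (mulIf q0').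
    transitivity (expR (- chart_x u) ^+ 2 * (h (r * r + c * c) *
        (h (r * r + c * c) + 2 * (b - a)) * expR (chart_x u) ^+ 2)).
      by rewrite Ph -{1}ns2 ns12 !expr2.
    transitivity ((expR (chart_x u) * expR (- chart_x u)) ^+ 2 *
      ((h (r * r + c * c) + 2 * (b - a)) * h (r * r + c * c))); first by ring.
    by rewrite XX; ring.
  have pnz : (z1 p, z2 p) <> (0, 0).
    move=> -[_ _ /eqP]; rewrite -/(xc _ _) hx2 mulf_eq0 !gt_eqF //.
  split.
  + split=> //; apply/fibreE; split.
    * by rewrite hx3 xE ns1; field.
    * by rewrite hx3 xE ns2; field.
    * rewrite hx3 hy3 re im /al /be.
      transitivity (expR (chart_x u) * expR (- chart_x u) * c * (cos s ^+ 2 + sin s ^+ 2)); first by ring.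
      by rewrite XX cs; ring.
  + by split; [rewrite hx2 mulr_gt0|rewrite ns2].
  + apply/rowP; apply: ord3P; rewrite /chart_inv vec3E ?hx3 ?hy3 ?re ?im //.
      rewrite -/r /al /be.
      transitivity (expR (chart_x u) * expR (- chart_x u) * r * (cos s ^+ 2 + sin s ^+ 2)); first by ring.
      by rewrite XX cs; ring.
    by rewrite hx2 hy2 mulrC mulKf // mulf_neq0 // gt_eqF.
- exact: chart_phiK.
Qed.

End Chart.
End FibreChart.

(** * Symmetries, and the smooth part as a Lagrangian soliton *)

Section Submanifold.
Variable R : realType.
Implicit Types (p : 'rV[R]_(3 + 3)).

(** Multiplies z_1 by al - i be and z_2 by al + i be. For a unit number this is an element of the
    action with opposite angles; it fixes z_3, so it is linear and preserves [mu]. *)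
Definition rot (al be : R) p : 'rV[R]_(3 + 3) :=
  C3 ((al * xc o0 p + be * yc o0 p) +i* (al * yc o0 p - be * xc o0 p))
     ((al * xc o1 p - be * yc o1 p) +i* (al * yc o1 p + be * xc o1 p))
     (xc o2 p +i* yc o2 p).

Lemma rot_is_linear al be : linear (rot al be).
Proof.
move=> k p q; apply: row6P; apply: ord3P;
  rewrite !(xcD, ycD, xcZ, ycZ) /rot !(xcC3, ycC3) /= !(xcD, ycD, xcZ, ycZ) //; ring.
Qed.
HB.instance Definition _ al be := GRing.isLinear.Build R _ _ _ (rot al be) (rot_is_linear al be).

Definition swap p : 'rV[R]_(3 + 3) :=
  C3 (xc o1 p +i* yc o1 p) (xc o0 p +i* yc o0 p) (xc o2 p +i* yc o2 p).

Lemma swap_is_linear : linear swap.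
Proof.
move=> k p q; apply: row6P; apply: ord3P;
  rewrite !(xcD, ycD, xcZ, ycZ) /swap !(xcC3, ycC3) /= !(xcD, ycD, xcZ, ycZ) //; ring.
Qed.
HB.instance Definition _ := GRing.isLinear.Build R _ _ _ swap swap_is_linear.

Lemma swapK : cancel swap swap.
Proof.
move=> p; apply: row6P; apply: ord3P; rewrite /swap !(xcC3, ycC3) /= ?(xcC3, ycC3) //.
Qed.

Lemma rotK al be : al ^+ 2 + be ^+ 2 = 1 -> cancel (rot al be) (rot al (- be)).
Proof.
move=> ab p; have ab' : al ^+ 2 = 1 - be ^+ 2 by rewrite -ab addrK.
by apply: row6P; apply: ord3P; rewrite /rot !(xcC3, ycC3) /= ?(xcC3, ycC3) /=; ring: ab'.
Qed.

Lemma znz p : (z1 p, z2 p) <> (0, 0) <-> nsq1 p + nsq2 p != 0.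
Proof.
rewrite /nsq1 /nsq2; split=> h.
  apply: contra_notN h; rewrite !paddr_eq0 ?addr_ge0 ?sqr_ge0 // !sqrf_eq0.
  by move=> /andP[/andP[/eqP a /eqP b] /andP[/eqP c /eqP d]]; rewrite z1E z2E a b c d.
move=> [a b c d]; move: h; rewrite /xc /yc.
by rewrite a b c d !expr0n /= !addr0 eqxx.
Qed.

Lemma smooth_partE (a b c : R) p : smooth_part (fibre a b c) p <->
  fibre a b c p /\ nsq1 p + nsq2 p != 0.
Proof. by rewrite /smooth_part /=; split=> -[? ?]; split => //; exact/znz. Qed.

Lemma smooth_part_rot (a b c : R) al be p : al ^+ 2 + be ^+ 2 = 1 ->
  smooth_part (fibre a b c) p -> smooth_part (fibre a b c) (rot al be p).
Proof.
move=> ab /smooth_partE[/fibreE[e1 e2 e3] nz].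
have ab' : al ^+ 2 = 1 - be ^+ 2 by rewrite -ab addrK.
have n1 : nsq1 (rot al be p) = nsq1 p.
  by rewrite /nsq1 /rot !(xcC3, ycC3) /=; ring: ab'.
have n2 : nsq2 (rot al be p) = nsq2 p.
  by rewrite /nsq2 /rot !(xcC3, ycC3) /=; ring: ab'.
have re : re12 (rot al be p) = re12 p.
  by rewrite /re12 /rot !(xcC3, ycC3) /=; ring: ab'.
have im : im12 (rot al be p) = im12 p.
  by rewrite /im12 /rot !(xcC3, ycC3) /=; ring: ab'.
apply/smooth_partE; rewrite n1 n2; split => //; apply/fibreE.
by rewrite n1 n2 re im /rot !(xcC3, ycC3).
Qed.

Lemma smooth_part_swap (a b c : R) p :
  smooth_part (fibre a b c) p -> smooth_part (fibre b a c) (swap p).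
Proof.
move=> /smooth_partE[/fibreE[e1 e2 e3] nz].
have n1 : nsq1 (swap p) = nsq2 p by rewrite /nsq1 /swap !(xcC3, ycC3).
have n2 : nsq2 (swap p) = nsq1 p by rewrite /nsq2 /swap !(xcC3, ycC3).
have re : re12 (swap p) = re12 p by rewrite /re12 /swap !(xcC3, ycC3) /=; ring.
have im : im12 (swap p) = im12 p by rewrite /im12 /swap !(xcC3, ycC3) /=; ring.
apply/smooth_partE; rewrite n1 n2 addrC; split => //; apply/fibreE.
by rewrite n1 n2 re im /swap !(xcC3, ycC3).
Qed.

(** At q = |z_2|^2 the derivative of [profile] equals [gdet] e^(2 Re z_3), hence is positive and
    [profile] can be inverted there. *)
Lemma regular_pos (a b c : R) p : smooth_part (fibre a b c) p -> 0 < xc o1 p ->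
  regular_at 3 (smooth_part (fibre a b c)) p.
Proof.
move=> Lp x0; have [/fibreE[e1 e2 e3] nz] := Lp.
have q0 : 0 < nsq2 p by rewrite /nsq2 ltr_wpDr ?sqr_ge0 // exprn_gt0.
have n1 : 0 <= nsq1 p by rewrite addr_ge0 ?sqr_ge0.
have dp : 0 < dprofile a b (nsq2 p).
  rewrite /dprofile mulr_gt0 ?expR_gt0 //.
  rewrite (_ : nsq2 p + 2 * (b - a) = nsq1 p); last by lra.
  rewrite (_ : 2 * (nsq2 p + (b - a)) = nsq2 p + nsq1 p); last by lra.
  have := mulr_ge0 (ltW q0) n1; lra.
have nJ : nbhs (nsq2 p) [set q : R | 0 < q].
  by apply: open_nbhs_nbhs; split => //; exact: open_gt.
have [I [J [h [oI oJ Jq JJ [sh hP hK]]]]] :=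
  smooth_local_inverse (is_derive_profile a b) (smooth_dprofile a b) dp nJ.
have rp : chart_rng J p by split.
exists (chart_dom c I), (chart_phi b c h); split.
  exact: (chart_param c oI oJ JJ sh hP hK).
have [d1 d2] := chart_phiK JJ hK Lp rp.
by exists (chart_inv p).
Qed.

Lemma regular_transport n N (L L' : set 'rV[R]_N) (f g : {linear 'rV[R]_N -> 'rV[R]_N}) (p : 'rV[R]_N) :
  cancel f g -> cancel g f -> (forall q : 'rV[R]_N, L q -> L' (f q)) ->
  (forall q : 'rV[R]_N, L' q -> L (g q)) -> regular_at n L (g p) -> regular_at n L' p.
Proof.
move=> fK gK LL' L'L [V [phi [lp [u Vu e]]]].
exists V, (f \o phi); split; first exact: (local_param_transport fK gK LL' L'L lp).
by exists u => //=; rewrite e gK.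
Qed.

Lemma regular_z2 (a b c : R) p : smooth_part (fibre a b c) p -> 0 < nsq2 p ->
  regular_at 3 (smooth_part (fibre a b c)) p.
Proof.
move=> Lp q0; have s0 : 0 < Num.sqrt (nsq2 p) by rewrite sqrtr_gt0.
have s2 : Num.sqrt (nsq2 p) ^+ 2 = nsq2 p by rewrite sqr_sqrtr // ltW.
(* al + i be = conj z_2 / |z_2|, which turns z_2 into the positive number |z_2|. *)
pose al := xc o1 p / Num.sqrt (nsq2 p); pose be := - yc o1 p / Num.sqrt (nsq2 p).
have ab : al ^+ 2 + be ^+ 2 = 1.
  rewrite /al /be !expr_div_n s2 sqrrN -mulrDl divff // gt_eqF //.
have ab' : al ^+ 2 + (- be) ^+ 2 = 1 by rewrite sqrrN.
have K1 := rotK ab; have K2 := rotK ab'; rewrite opprK in K2.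
apply: (@regular_transport _ _ _ _ (rot al (- be)) (rot al be)) => //.
- by move=> q; exact: smooth_part_rot.
- by move=> q; exact: smooth_part_rot.
apply: regular_pos; first exact: smooth_part_rot.
rewrite /rot xcC3 /= /al /be.
rewrite (_ : _ - _ = Num.sqrt (nsq2 p)) //.
rewrite mulNr mulNr opprK -!mulrA ![_^-1 * _]mulrC !mulrA -mulrDl -!expr2 -/(nsq2 p).
by rewrite -{1}s2 expr2 mulfK // gt_eqF.
Qed.

(** Where z_2 = 0, z_1 is not zero, and exchanging the two coordinates passes to the fibre over (b,
    a, c). *)
Lemma smooth_part_submanifold (a b c : R) : submanifold 3 (smooth_part (fibre a b c)).
Proof.
move=> p Lp; have [_ nz] := (smooth_partE a b c p).1 Lp.
have n1 : 0 <= nsq1 p by rewrite addr_ge0 ?sqr_ge0.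
have n2 : 0 <= nsq2 p by rewrite addr_ge0 ?sqr_ge0.
have [p2|p2] := ltP 0 (nsq2 p); first exact: regular_z2.
have e2 : nsq2 p = 0 by apply/eqP; rewrite eq_le p2.
apply: (@regular_transport _ _ _ _ swap swap _ swapK swapK); first exact: smooth_part_swap.
  exact: smooth_part_swap.
apply: regular_z2; first exact: smooth_part_swap.
rewrite lt_neqAle addr_ge0 ?sqr_ge0 // andbT eq_sym /nsq2 /swap !(xcC3, ycC3) /=.
by move: nz; rewrite e2 addr0.
Qed.

Lemma smooth_part_lagrangian (a b c : R) : lagrangian (smooth_part (fibre a b c)).
Proof.
split; first exact: smooth_part_submanifold.
move=> p X Y Lp [V [phi [u [v [lp Vu e ->]]]]] [V' [phi' [u' [v' [lp' Vu' e' ->]]]]].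
apply: (@tangent_isotropic _ p); first by case: Lp.
  by rewrite -e; exact: (param_tangent lp).
by rewrite -e'; exact: (param_tangent lp').
Qed.

Lemma smooth_part_soliton (a b c : R) :
  lagrangian_translating_soliton (e3 R) (smooth_part (fibre a b c)).
Proof.
split; first exact: smooth_part_lagrangian.
by move=> V phi lp u Vu; exact: (soliton_equation lp).
Qed.

Lemma smooth_part_hamiltonian_stationary (a b : R) :
  hamiltonian_stationary (smooth_part (fibre a b 0)).
Proof.
split; first exact: smooth_part_lagrangian.
  move=> p /smooth_part_submanifold[V [phi [lp [u Vu e]]]].
  have [V' [theta [lp' Vu' la]]] := lagrangian_angle_ex lp Vu.
  by exists V', phi, theta; split => //; exists u.
by move=> V phi theta lp la u Vu; exact: (angle_harmonic lp erefl la).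
Qed.

End Submanifold.

(** * The group action and its isotropy *)

Section Cohomogeneity.
Variable R : realType.
Implicit Types (p : 'rV[R]_(3 + 3)) (g : 'rV[R]_2).

Lemma act_coord g p : let t1 := g 0 0 in let t2 := g 0 1 in
  (xc o0 (act g p) = cos t1 * xc o0 p - sin t1 * yc o0 p)
  * (yc o0 (act g p) = cos t1 * yc o0 p + sin t1 * xc o0 p)
  * (xc o1 (act g p) = cos t2 * xc o1 p - sin t2 * yc o1 p)
  * (yc o1 (act g p) = cos t2 * yc o1 p + sin t2 * xc o1 p)
  * (xc o2 (act g p) = xc o2 p)
  * (yc o2 (act g p) = yc o2 p - (t1 + t2)).
Proof. by rewrite /act !xcC3 !ycC3 !z1E !z2E !z3E /= subr0. Qed.

Lemma smooth_part_act (a b c : R) g p :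
  smooth_part (fibre a b c) p -> smooth_part (fibre a b c) (act g p).
Proof.
move=> /smooth_partE[/fibreE[e1 e2 e3] nz].
have cs1 := cosx2 (g 0 0); have cs2 := cosx2 (g 0 1).
have n1 : nsq1 (act g p) = nsq1 p by rewrite /nsq1 !act_coord; ring: cs1.
have n2 : nsq2 (act g p) = nsq2 p by rewrite /nsq2 !act_coord; ring: cs2.
apply/smooth_partE; rewrite n1 n2; split => //; apply/fibreE; rewrite n1 n2.
split; rewrite ?act_coord //; rewrite -e3; congr (_ * _).
rewrite /re12 /im12 !act_coord cosB sinB cosD sinD.
by ring: cs1 cs2.
Qed.

(** The discrete group of all (2 pi k, - 2 pi k). Fixing z_3 forces opposite angles, and then either
    nonzero coordinate forces the cosine to be 1. *)
Definition stabilizer : set 'rV[R]_2 := [set g | g 0 0 + g 0 1 = 0 /\ cos (g 0 0) = 1].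

Lemma cos1_sin0 (t : R) : cos t = 1 -> sin t = 0.
Proof.
move=> c1; have := cosx2 t; rewrite c1 expr1n => /eqP.
by rewrite eq_sym subr_eq addrC -subr_eq subrr eq_sym sqrf_eq0 => /eqP.
Qed.

(** Pairing the rotated vector with (x, y) gives cos t times the squared length. *)
Lemma rot_fixed (x y t : R) : x ^+ 2 + y ^+ 2 != 0 ->
  cos t * x - sin t * y = x -> cos t * y + sin t * x = y -> cos t = 1.
Proof.
move=> n0 e1 e2; apply: (mulIf n0); transitivity (x * (cos t * x - sin t * y) + y * (cos t * y + sin t * x)).
  by ring.
by rewrite e1 e2; ring.
Qed.

Lemma isotropyE (a b c : R) p : smooth_part (fibre a b c) p ->
  isotropy (@act R) p = stabilizer.
Proof.
move=> /smooth_partE[_ nz]; apply/seteqP; split=> g.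
  rewrite /isotropy /= => e.
  have ey := congr1 (yc o2) e; have ex0 := congr1 (xc o0) e; have ey0 := congr1 (yc o0) e.
  have ex1 := congr1 (xc o1) e; have ey1 := congr1 (yc o1) e.
  rewrite !act_coord in ey ex0 ey0 ex1 ey1.
  have t0 : g 0 0 + g 0 1 = 0 by lra.
  split => //; have [n1|n1] := eqVneq (nsq1 p) 0; last exact: rot_fixed n1 ex0 ey0.
  rewrite n1 add0r in nz; have := rot_fixed nz ex1 ey1.
  by rewrite (_ : g 0 1 = - g 0 0) ?cosN //; lra.
move=> [t0 c1]; have s1 := cos1_sin0 c1.
have t1 : g 0 1 = - g 0 0 by lra.
by apply: row6P; apply: ord3P; rewrite !act_coord ?t1 ?cosN ?sinN ?c1 ?s1; ring.
Qed.

Lemma smooth_part_cohomogeneity_one (a b c : R) :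
  cohomogeneity_one 3 (@act R) (smooth_part (fibre a b c)).
Proof.
split; [exact: smooth_part_submanifold|by move=> g p; exact: smooth_part_act|].
have cc j : continuous (fun g : 'rV[R]_2 => g 0 j) by exact: coord_continuous.
exists stabilizer; split.
- rewrite (_ : stabilizer = (fun g : 'rV[R]_2 => g 0 0 + g 0 1) @^-1` [set 0]
    `&` (fun g : 'rV[R]_2 => cos (g 0 0)) @^-1` [set 1]) //.
  apply: closedI; apply: closed_comp; try exact: closed_eq.
    by move=> g _; apply: continuousD; exact: cc.
  by move=> g _; apply: continuous_comp; [exact: cc|exact: continuous_cos].
- split; first by rewrite /stabilizer /= !mxE addr0 cos0.
  move=> g h [g0 gc] [h0 hc]; split; rewrite !mxE.
    by rewrite addrACA -opprD g0 h0 subr0.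
  by rewrite cosB gc hc (cos1_sin0 gc) mul0r addr0 mulr1.
- move=> p Lp; exists 0; rewrite (isotropyE Lp); apply/seteqP; split=> g.
    by move=> sg; exists g => //; rewrite add0r subr0.
  by move=> [h sh <-]; rewrite add0r subr0.
- exists 2%N => //; exists 0%VS; rewrite dimv0; split => // X; rewrite memv0; split.
    by move=> /eqP -> t; rewrite scaler0 /stabilizer /= !mxE addr0 cos0.
  move=> H; have x0 : X 0 0 = 0.
    (* At time pi / X 0 0 the one-parameter group would reach an element with cosine -1. *)
    apply: contrapT => /eqP x0; have [_] := H (pi / X 0 0).
    rewrite mxE divfK // cospi => /eqP; rewrite -subr_eq0 => /eqP; lra.
  have [+ _] := H 1; rewrite !mxE x0 mulr0 add0r mul1r => x1.
  apply/eqP/rowP => -[[|[|//]]] lt; rewrite mxE.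
    by rewrite -[RHS]x0; congr (X _ _); exact: val_inj.
  by rewrite -[RHS]x1; congr (X _ _); exact: val_inj.
Qed.

End Cohomogeneity.

(** * Surjectivity of the differential of [mu] *)

Section Surjectivity.
Variable R : realType.

Lemma diff_muE (p v : 'rV[R]_(3 + 3)) : 'd (@mu R) p v = dmu p v.
Proof. by have d := is_diff_mu p; rewrite (@diff_val _ _ _ _ _ _ _ d). Qed.

Lemma diff_mu_surjective (p : 'rV[R]_(3 + 3)) :
  (forall w : 'rV[R]_3, exists v, 'd (@mu R) p v = w) <-> (z1 p, z2 p) <> (0, 0).
Proof.
split=> [sur [a b c d]|nz w].
  (* At z_1 = z_2 = 0 the third normal vanishes, so the third unit vector is not attained. *)
  have [v] := sur (vec3 0 0 1); rewrite diff_muE => /(congr1 (fun q : 'rV[R]_3 => q 0 o2)).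
  rewrite /= /dmu !vec3E dotvE /nv3 !(xcC3, ycC3) /= /re12 /im12 /xc /yc a b c d.
  by rewrite !(mulr0, mul0r, addr0, subr0) => /eqP; rewrite eq_sym oner_eq0.
(* A combination of normals with prescribed pairings w'; the division undoes the factor e^(Re z_3)
   in [dmu]. *)
pose w' := vec3 (w 0 o0) (w 0 o1) (w 0 o2 / expR (xc o2 p)).
exists (w' *m igram p *m nframe p); rewrite diff_muE; set v := w' *m _ *m _.
have [_ nn _] := frame_gram p.
have vN : v *m (nframe p)^T = w'.
  by rewrite /v -!mulmxA nn (mulmx1C (gram_igram nz)) mulmx1.
have vNE i : dotv (row i (nframe p)) v = w' 0 i.
  by rewrite -vN mxE dotv_sym /dotv; apply: eq_bigr => k _; rewrite !mxE.
have := (vNE o0, vNE o1, vNE o2); rewrite !row_nframe /w' !vec3E => -[[h0 h1] h2].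
apply/rowP; apply: ord3P; rewrite /dmu !vec3E ?h0 ?h1 ?h2 //.
by rewrite mulrC divfK // gt_eqF // expR_gt0.
Qed.

End Surjectivity.

(** * Velocities of curves through a regular point *)

Section TangentCone.
Variable R : realType.

(* phi is bi-Lipschitz at u, so a curve in L through phi u lifts to a curve whose
   difference quotients are bounded; its velocity then lies in the closed range of the differential. *)
Lemma parabola_velocity n N (L : set 'rV[R]_N) (V : set 'rV[R]_n)
    (phi : 'rV[R]_n -> 'rV[R]_N) u (v w : 'rV[R]_N) : local_param L V phi -> V u ->
  (forall s : R, L (phi u + s *: v + (s * s) *: w)) -> (v <= frame phi u)%MS.
Proof.
move=> lp Vu Lc; set D := frame phi u.
have dphi : differentiable phi u := smooth_diff (lp_smooth lp) Vu.
have [P DP] : exists P, D *m P = 1%:M.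
  by apply/row_freeP; apply: frame_free => //; exact: (lp_immersion lp).
(* Right multiplication by [Q] kills exactly the row space of D. *)
pose Q := 1%:M - P *m D.
have DQ : D *m Q = 0 by rewrite mulmxBr mulmx1 mulmxA DP mul1mx subrr.
suff vQ : v *m Q = 0.
  have : v = (v *m P) *m D.
    by apply/eqP; rewrite -subr_eq0 -mulmxA -{1}(mulmx1 v) -mulmxBr vQ.
  by move=> ->; exact: submxMl.
have lipP : exists2 k, 0 < k & forall x : 'rV[R]_N, `|x *m P| <= k * `|x|.
  have [k k0 kP] := linear_lipschitz (@linear_rV_continuous _ _ _ (mulmxr P : {linear 'rV[R]_N -> 'rV[R]_n})).
  by exists k.
have lipQ : exists2 k, 0 < k & forall x : 'rV[R]_N, `|x *m Q| <= k * `|x|.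
  have [k k0 kQ] := linear_lipschitz (@linear_rV_continuous _ _ _ (mulmxr Q : {linear 'rV[R]_N -> 'rV[R]_N})).
  by exists k.
have [kP kP0 hP] := lipP; have [kQ kQ0 hQ] := lipQ.
apply/eqP; rewrite -normr_le0; apply/ler_addgt0Pl => e e0; rewrite addr0.
pose B := `|v| + `|w|.
have B0 : 0 <= B by rewrite addr_ge0.
pose M := 4 * kP * kQ * (B + 1).
have M0 : 0 < M by rewrite !mulr_gt0 // ltr_wpDl.
(* The first bound gives |h| <= 2 kP |dl|. The second bounds dl Q by s e / 2: the 4 in [M] is the
   product of this 2 and of the halving of e. *)
pose eps := Num.min (1 / (2 * kP)) (e / M).
have eps0 : 0 < eps by rewrite lt_min !divr_gt0 // mulr_gt0.
have epsP : eps * kP <= 1 / 2.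
  rewrite -ler_pdivlMr //; apply: (@le_trans _ _ (1 / (2 * kP))); first by rewrite ge_min lexx.
  by rewrite le_eqVlt; apply/orP; left; apply/eqP; field; rewrite gt_eqF.
have epsM : eps * M <= e by rewrite -ler_pdivlMr // ge_min lexx orbT.
have near_lip : \forall h \near (0 : 'rV[R]_n), `|phi (h + u) - phi u - h *m D| <= eps * `|h|.
  have /diff_locallyP[_ /eqaddoP/(_ eps eps0)] := dphi.
  by apply: filterS => h; rewrite !fctE /= opprD addrA diff_frame.
have near_u : \forall y \near u, `|phi y - phi u - (y - u) *m D| <= eps * `|y - u|.
  rewrite (near_shift 0) /=; move: near_lip; apply: filterS => h /=.
  by rewrite subr0 addrK.
have near_tr : \forall y \near u, V y /\ `|phi y - phi u - (y - u) *m D| <= eps * `|y - u|.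
  by apply: filterI => //; apply: open_nbhs_nbhs; split; [exact: (lp_open lp)|].
have [r r0 rP] : exists2 r : R, 0 < r & forall y, ball u r y ->
    V y /\ `|phi y - phi u - (y - u) *m D| <= eps * `|y - u|.
  by move: near_tr => /nbhs_ballP[r r0 rP]; exists r.
have oB : open (ball u r) by exact: ball_open.
have BV : ball u r `<=` V by move=> y /rP[].
have [U oU eU] := lp_homeo lp oB BV.
pose c (s : R) := phi u + s *: v + (s * s) *: w.
have cc : continuous c.
  move=> s; apply: cvgD; last first.
    by apply: cvgZr_tmp; apply: cvgM; exact: cvg_id.
  by apply: cvgD; [exact: cvg_cst|apply: cvgZr_tmp; exact: cvg_id].
have c0 : c 0 = phi u by rewrite /c mul0r !scale0r !addr0.
have U0 : U (c 0).
  have : (phi @` ball u r) (phi u) by exists u => //; exact: ballxx.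
  by rewrite eU c0 => -[].
have nU : \forall s \near (0 : R), U (c s).
  by apply: (cc 0 U); exact: open_nbhs_nbhs.
have [d d0 dU] : exists2 d : R, 0 < d & forall s, ball 0 d s -> U (c s).
  by move: nU => /nbhs_ballP[d d0 dU]; exists d.
(* The three bounds keep the curve in U, make s^2 <= s, and limit the contribution of the quadratic
   term to half of e. *)
pose s := Num.min (d / 2) (Num.min 1 (e / 2 / (`|w *m Q| + 1))).
have w0 : 0 < `|w *m Q| + 1 by rewrite ltr_wpDl.
have s0 : 0 < s by rewrite !lt_min ltr01 !divr_gt0.
have s0W := ltW s0; have kP0W := ltW kP0; have kQ0W := ltW kQ0; have eps0W := ltW eps0.
have s1 : s <= 1 by rewrite /s !ge_min lexx orbT.
have sd : s < d.
  apply: (@le_lt_trans _ _ (d / 2)); first by rewrite /s ge_min lexx.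
  by rewrite ltr_pdivrMr // mulr_natr mulr2n ltrDl.
have sw : s * `|w *m Q| <= e / 2.
  apply: (@le_trans _ _ (s * (`|w *m Q| + 1))); first by rewrite ler_wpM2l // lerDl.
  by rewrite -ler_pdivlMr // /s !ge_min lexx !orbT.
have [y By ey] : (phi @` ball u r) (c s).
  rewrite eU; split; first exact: Lc.
  by apply: dU; rewrite -ball_normE /= sub0r normrN gtr0_norm.
have [_ ley] := rP y By.
set h := y - u in ley.
set dl := phi y - phi u in ley.
have dlE : dl = s *: v + (s * s) *: w by rewrite /dl ey /c addrAC [X in X + _]addrAC subrr add0r.
clearbody dl h.
have n1 : `|dl| <= s * B.
  rewrite dlE; apply: (le_trans (ler_normD _ _)).
  rewrite !normrZ ?normrM !(gtr0_norm s0) /B mulrDr lerD //.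
  by rewrite ler_wpM2r // -[leRHS]mulr1 ler_wpM2l.
have n2 : `|h *m D| <= `|dl| + eps * `|h|.
  have -> : h *m D = dl - (dl - h *m D) by rewrite subKr.
  by apply: (le_trans (ler_normB _ _)); rewrite lerD2l.
have n3 : `|h| <= kP * (`|dl| + eps * `|h|).
  rewrite -{1}(mulmx1 h) -DP mulmxA; apply: (le_trans (hP _)).
  by rewrite ler_wpM2l.
have n4 : `|h| <= 2 * kP * `|dl|.
  have := ler_wpM2r (normr_ge0 h) epsP; move: n3; move: (`|h|) (`|dl|) => x z; nra.
have n5 : `|dl *m Q| <= kQ * (eps * `|h|).
  have -> : dl *m Q = (dl - h *m D) *m Q by rewrite mulmxBl -(mulmxA h) DQ mulmx0 subr0.
  by apply: (le_trans (hQ _)); rewrite ler_wpM2l.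
have n6 : s * `|v *m Q| <= `|dl *m Q| + s * s * `|w *m Q|.
  have -> : s * `|v *m Q| = `|dl *m Q - (s * s) *: (w *m Q)|.
    by rewrite dlE mulmxDl -!scalemxAl addrK normrZ gtr0_norm.
  apply: (le_trans (ler_normB _ _)).
  by rewrite normrZ ?normrM !(gtr0_norm s0).
have n7 : `|dl *m Q| <= s * (e / 2).
  apply: (le_trans n5).
  apply: (@le_trans _ _ (kQ * (eps * (2 * kP * (s * B))))).
    rewrite !ler_wpM2l //; apply: (le_trans n4).
    by rewrite ler_wpM2l // mulr_ge0.
  apply: (@le_trans _ _ (s * (eps * M / 2))); last first.
    by rewrite ler_wpM2l // ler_pM2r.
  rewrite (_ : kQ * _ = s * (eps * (4 * kP * kQ * B) / 2)); last by field.
  rewrite ler_wpM2l // ler_pM2r // ler_wpM2l // /M ler_wpM2l ?lerDl //.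
  by rewrite !mulr_ge0.
have n8 : s * `|v *m Q| <= s * e.
  apply: (le_trans n6); rewrite [e in leRHS](splitr e) mulrDr lerD // -mulrA.
  by rewrite ler_wpM2l.
by move: n8; rewrite ler_pM2l.
Qed.

End TangentCone.

(** * The singular line of the fibre over (a, a, 0) *)

Section SingularSet.
Variable R : realType.
Implicit Types (p : 'rV[R]_(3 + 3)).

Lemma regular_open n N (L O : set 'rV[R]_N) (p : 'rV[R]_N) : open O ->
  regular_at n (L `&` O) p -> regular_at n L p.
Proof.
move=> oO [V [phi [[oV sm im inj hom] Vp]]]; exists V, phi; split => //.
split => // W oW WV; have [U oU e] := hom W oW WV.
by exists (O `&` U); [exact: openI|rewrite e setIA].
Qed.

Lemma smooth_part_open (L : set 'rV[R]_(3 + 3)) :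
  exists2 O : set 'rV[R]_(3 + 3), open O & smooth_part L = L `&` O.
Proof.
exists [set p | nsq1 p + nsq2 p != 0].
  apply: (@open_comp _ _ (fun p => nsq1 p + nsq2 p) [set x : R | x != 0]); last exact: open_neq0.
  move=> p _; apply: differentiable_continuous.
  have dx j := is_diff_xc p j; have dy j := is_diff_yc p j.
  have dd := is_diff_addf (is_diff_addf (is_diff_mulf (dx o0) (dx o0)) (is_diff_mulf (dy o0) (dy o0)))
    (is_diff_addf (is_diff_mulf (dx o1) (dx o1)) (is_diff_mulf (dy o1) (dy o1))).
  exact: (@ex_diff _ _ _ _ _ _ _ dd).
by apply/seteqP; split=> p [Lp] /znz.
Qed.

(* The fibre near (0, 0, a + it) is the union of the two sheets
   z_2 = + e^(-i Im z_3) conj z_1 and z_2 = - e^(-i Im z_3) conj z_1,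
   whose tangent spaces span more than three dimensions. *)
Definition cone_dir (t x y eps : R) : 'rV[R]_(3 + 3) :=
  C3 (x +i* y) ((eps * (cos t * x - sin t * y)) +i* (- eps * (cos t * y + sin t * x))) 0.

(** On these curves |z_1| = |z_2|, the quadratic term supplies the growth |z_1|^2 / 2 of Re z_3, and
    z_1 z_2 e^(it) = eps |z_1|^2 is real. *)
Lemma cone_dir_fibre (a t x y eps s : R) : eps ^+ 2 = 1 ->
  fibre a a 0 (C3 0 0 (a +i* t) + s *: cone_dir t x y eps
    + (s * s) *: (((x ^+ 2 + y ^+ 2) / 2) *: e3 R)).
Proof.
move=> /eqP; rewrite sqrf_eq1 => e1; have cs := cosx2 t.
apply/fibreE; rewrite /nsq1 /nsq2 /im12 /re12 !(xcD, ycD, xcZ, ycZ) !xc_e3 /cone_dir.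
rewrite !(xcC3, ycC3) /= !(mulr0, add0r, addr0, mulr1).
split; first by field.
  by case/orP: e1 => /eqP ->; field: cs.
rewrite [X in _ * X](_ : _ = 0) ?mulr0 //.
by ring: cs.
Qed.

Lemma line_singular (a t : R) : ~ regular_at 3 (fibre a a 0) (C3 0 0 (a +i* t) : 'rV[R]_(3 + 3)).
Proof.
move=> [V [phi [lp [u Vu e]]]].
have sub x y eps : eps ^+ 2 = 1 -> (cone_dir t x y eps <= frame phi u)%MS.
  move=> e1; apply: (parabola_velocity (w := ((x ^+ 2 + y ^+ 2) / 2) *: e3 R) lp Vu) => s.
  by rewrite e; exact: cone_dir_fibre.
have n1 : (-1 : R) ^+ 2 = 1 by rewrite sqrrN expr1n.
have p1 : (1 : R) ^+ 2 = 1 by rewrite expr1n.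
pose F : 'M[R]_(4, 3 + 3) := \matrix_(i < 4) [:: cone_dir t 1 0 1; cone_dir t 1 0 (-1);
   cone_dir t 0 1 1; cone_dir t 0 1 (-1)]`_i.
have FD : (F <= frame phi u)%MS.
  apply/row_subP => -[[|[|[|[|//]]]] lt]; rewrite rowK /=; exact: sub.
(* Four orthogonal rows of squared length 2, to be contained in the span of three. *)
have FF : F *m F^T = 2%:M.
  have cs := cosx2 t.
  have dE (i j : 'I_4) : (F *m F^T) i j = dotv (row i F) (row j F).
    by rewrite mxE /dotv; apply: eq_bigr => k _; rewrite !mxE.
  apply/matrixP => -[[|[|[|[|//]]]] lt] -[[|[|[|[|//]]]] lt'];
    rewrite dE !rowK /= dotvE /cone_dir !(xcC3, ycC3) mxE /=; ring: cs.
have rF : row_free F.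
  apply/row_freeP; exists (2^-1 *: F^T).
  by rewrite -scalemxAr FF scale_scalar_mx mulVf // pnatr_eq0.
have := mxrankS FD; rewrite (eqP rF) => /leq_trans/(_ (rank_leq_row _)).
by [].
Qed.

Lemma fibre_singular_locus (a : R) :
  fibre a a 0 `\` smooth_part (fibre a a 0) = [set C3 0 0 (a +i* t) | t in [set: R]].
Proof.
apply/seteqP; split=> p.
  move=> [Lp nS].
  have z0 : nsq1 p + nsq2 p = 0.
    by apply: contrapT => /eqP nz; apply: nS; split => //; exact/znz.
  have [e1 _ _] := (fibreE a a 0 p).1 Lp.
  exists (yc o2 p) => //.
  move/eqP: z0; rewrite /nsq1 /nsq2 !paddr_eq0 ?addr_ge0 ?sqr_ge0 // !sqrf_eq0.
  move=> /andP[/andP[/eqP h1 /eqP h2] /andP[/eqP h3 /eqP h4]].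
  apply: row6P; apply: ord3P; rewrite !(xcC3, ycC3) /= ?h1 ?h2 ?h3 ?h4 //.
  by rewrite e1 /nsq1 h1 h2 expr0n /= addr0 mul0r addr0.
move=> [t _ <-]; split.
  apply/fibreE; rewrite /nsq1 /nsq2 /im12 /re12 !(xcC3, ycC3) /=.
  by split; rewrite ?expr0n /= ?(mulr0, mul0r, addr0, subr0).
move=> [_ /znz]; rewrite /nsq1 /nsq2 !(xcC3, ycC3) /=.
by rewrite expr0n /= !addr0 eqxx.
Qed.

(** The smooth part is relatively open, so its charts are charts of the fibre; the remaining points
    form the line. *)
Lemma fibre_singular_set (a : R) :
  singular_set 3 (fibre a a 0) = [set (C3 0 0 (a +i* t) : 'rV[R]_(3 + 3)) | t in [set: R]].
Proof.
apply/seteqP; split=> p.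
  move=> [Lp nreg]; rewrite -fibre_singular_locus; split => // Sp; apply: nreg.
  have [B oB e] := smooth_part_open (fibre a a 0).
  by apply: (regular_open oB); rewrite -e; exact: smooth_part_submanifold.
move=> lp; split; last by case: lp => t _ <-; exact: line_singular.
by move: lp; rewrite -fibre_singular_locus => -[].
Qed.

Lemma line_submanifold (a : R) :
  submanifold 1 [set (C3 0 0 (a +i* t) : 'rV[R]_(3 + 3)) | t in [set: R]].
Proof.
move=> p [t0 _ ep].
pose phi (u : 'rV[R]_1) : 'rV[R]_(3 + 3) := C3 0 0 (a +i* u 0 0).
pose g (p : 'rV[R]_(3 + 3)) : 'rV[R]_1 := \row_(j < 1) yc o2 p.
have gphi u : g (phi u) = u.
  by apply/rowP => j; rewrite mxE /phi ycC3 /= ord1.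
exists setT, phi; split; last by exists (g p) => //; rewrite /phi /g mxE -ep ycC3.
apply: (@local_param_left_inverse _ _ _ _ _ _ setT g).
- exact: openT.
- move=> k; apply: Ck_rV; first exact: openT.
  have ext (f h : 'rV[R]_1 -> R) : h =1 f -> smooth_on setT f -> Ck k setT h.
    by move=> /funext -> sf; exact: sf.
  have sc (x : R) := @smooth_cstf R 'rV[R]_1 setT x.
  have s0 : smooth_on setT (fun u : 'rV[R]_1 => u 0 0) by apply: smooth_coord; exact: openT.
  apply: ord6P; apply: ord3P; rewrite /phi.
  + by apply: (ext (fun=> 0)) => // u; rewrite -/(xc _ _) xcC3.
  + by apply: (ext (fun=> 0)) => // u; rewrite -/(xc _ _) xcC3.
  + by apply: (ext (fun=> a)) => // u; rewrite -/(xc _ _) xcC3.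
  + by apply: (ext (fun=> 0)) => // u; rewrite -/(yc _ _) ycC3.
  + by apply: (ext (fun=> 0)) => // u; rewrite -/(yc _ _) ycC3.
  + by apply: (ext (fun u => u 0 0)) => // u; rewrite -/(yc _ _) ycC3.
- exact: openT.
- move=> q _; apply: differentiable_rV => j.
  by apply: (is_diff_ex _ (is_diff_yc q o2)) => r; rewrite mxE.
- by move=> u _; split => //; exists (u 0 0).
- by move=> q [t _ <-] _; split=> //; rewrite /phi /g mxE ycC3.
Qed.

End SingularSet.

Theorem mainTheorem6 (R : realType) :
  (forall p : 'rV[R]_(3 + 3),
     (forall w : 'rV[R]_3, exists v, 'd (@mu R) p v = w)
     <-> (z1 p, z2 p) <> (0, 0))
  /\
  (forall a b c : R,
     cohomogeneity_one 3 (@act R) (smooth_part (fibre a b c)) /\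
     lagrangian_translating_soliton (e3 R) (smooth_part (fibre a b c)))
  /\
  (forall a : R,
     let line := [set C3 0 0 (a +i* t) | t in [set: R]] in
     [/\ fibre a a 0 `\` smooth_part (fibre a a 0) = line,
         singular_set 3 (fibre a a 0) = line,
         submanifold 1 line
       & hamiltonian_stationary (smooth_part (fibre a a 0))]).
Proof.
split; first exact: diff_mu_surjective.
split=> [a b c|a].
  by split; [exact: smooth_part_cohomogeneity_one|exact: smooth_part_soliton].
split.
- exact: fibre_singular_locus.
- exact: fibre_singular_set.
- exact: line_submanifold.
- exact: smooth_part_hamiltonian_stationary.
Qed.
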